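(* Let $X$ be a finite graph and let $Y$ be a regular covering graph of $X$ with covering transformation group $\pi=\mathbb{Z}=\langle t\rangle$ (so $\mathbb{Z}$ acts freely on $Y$ with quotient $X$). Let $P_u(x)$ be the polynomial in $x$ (of degree $n$, with coefficients polynomials in $u$) such that \[ \det \Delta_u = P_u\!\left(\frac{t+t^{-1}}{2}\right). \] Then there is $R>0$ such that for all $0<|u|<R$ one can write $P_u(x) = \alpha(u)\prod_{i=1}^{n}(r_i(u)-x)$, where $r_1(u),\dots,r_n(u)$ are the roots of $P_u$, and \[ Z^{(2)}_Y(u)^{-1} = (1-u^2)^{-\chi(X)}\,\frac{\alpha(u)}{2^{n}}\prod_{i=1}^{n}\Bigl(r_i + \sqrt{r_i+1}\,\sqrt{r_i-1}\Bigr), \] where the square roots are principal, $\sqrt{z}=\exp(\tfrac12\log z)$ with $\log$ the principal logarithm.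
   Context: Let $Y=(VY,EY)$ be a locally finite graph with a free action of $\pi=\mathbb{Z}=\langle t\rangle$ whose quotient $X=Y/\mathbb{Z}$ is a finite graph; $\chi(X)$ is its Euler characteristic (vertices minus edges). Let $P$ be the set of free homotopy classes of primitive closed paths in $Y$; for $\gamma\in P$, $\mathrm{len}(\gamma)$ is the length of a shortest representative and $\pi_\gamma$ is the stabilizer of $\gamma$ in $\pi$. The $L^2$ zeta function of $Y$ is \[ Z^{(2)}_Y(u)^{-1} = \prod_{\gamma\in \pi\backslash P}\bigl(1-u^{\mathrm{len}(\gamma)}\bigr)^{1/|\pi_\gamma|}, \] which converges for small $|u|$. Choose a lift in $Y$ of each of the $v$ vertices of $X$; this identifies $\ell^2(VY)$ with $\bigoplus_{v}\ell^2(\mathbb{Z})$, so the adjacency operator $\delta$ of $Y$ becomes a $v\times v$ matrix with entries in the group ring $\mathbb{Z}[t,t^{-1}]$. Let $Q$ be the diagonal matrix with entry $q(w)$ at vertex $w$, where $q(w)+1$ is the degree of $w$. Put $\Delta_u = I - \delta u + Q u^2$, a $v\times v$ matrix over $\mathbb{Z}[u][t,t^{-1}]$. Its determinant $\det\Delta_u$ is a Laurent polynomial in $t$ symmetric under $t\leftrightarrow t^{-1}$, hence equals $P_u\bigl(\frac{t+t^{-1}}{2}\bigr)$ for a unique polynomial $P_u(x)$ whose coefficients are integer polynomials in $u$; it does not depend on the choice of lifts. $n$ denotes the degree of $P_u$ in $x$. *)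

(* Defs.v *)
From HB Require Import structures.
From mathcomp Require Import all_boot all_order all_algebra fraction.
From mathcomp Require Import finmap complex.
From mathcomp Require Import boolp classical_sets functions cardinality fsbigop.
From mathcomp Require Import reals topology normedtype sequences exp trigo.
Set Implicit Arguments.
Unset Strict Implicit.
Unset Printing Implicit Defensive.

Import Order.TTheory GRing.Theory Num.Theory.
Import numFieldNormedType.Exports.

Local Open Scope classical_set_scope.
Local Open Scope ring_scope.

(* Graphs in the sense of Serre: [E] is the set of oriented edges, [einv]
   reverses orientation, and a geometric edge is a pair {e, einv e}.  Loops and
   multiple edges are allowed. *)
Record graph (V E : choiceType) := Graph {
  org : E -> V;
  einv : E -> E;
  einvK : involutive einv;
  einv_neq : forall e, einv e != e
}.

Definition term (V E : choiceType) (Y : graph V E) (e : E) : V :=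
  org Y (einv Y e).

Record graph_map (V E : choiceType) (Y : graph V E)
    (V' E' : choiceType) (X : graph V' E') := GraphMap {
  mapV : V -> V';
  mapE : E -> E';
  map_org : forall e, org X (mapE e) = mapV (org Y e);
  map_einv : forall e, einv X (mapE e) = mapE (einv Y e)
}.

(* Action of the infinite cyclic group <t> by graph automorphisms: [actV k] and
   [actE k] are the actions of t^k. *)
Record zaction (V E : choiceType) (Y : graph V E) := ZAction {
  actV : int -> V -> V;
  actE : int -> E -> E;
  actV0 : forall y, actV 0 y = y;
  actVD : forall k l y, actV (k + l) y = actV k (actV l y);
  actE0 : forall e, actE 0 e = e;
  actED : forall k l e, actE (k + l) e = actE k (actE l e);
  act_org : forall k e, org Y (actE k e) = actV k (org Y e);
  act_einv : forall k e, einv Y (actE k e) = actE k (einv Y e)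
}.

(* Freeness on edges follows from freeness on vertices. *)
Definition free_action (V E : choiceType) (Y : graph V E) (a : zaction Y) : Prop :=
  forall k y, actV a k y = y -> k = 0.

(* [p] identifies X with the quotient graph Y / <t>. *)
Definition quotient_map (V E : choiceType) (Y : graph V E) (a : zaction Y)
    (V' E' : choiceType) (X : graph V' E') (p : graph_map Y X) : Prop :=
  [/\ forall x, exists y, mapV p y = x,
      forall f, exists e, mapE p e = f,
      forall y y', mapV p y = mapV p y' <-> exists k, y' = actV a k y
    & forall e e', mapE p e = mapE p e' <-> exists k, e' = actE a k e].

Definition euler_char (V E : finType) (X : graph V E) : int :=
  #|V|%:Z - (#|E|./2)%:Z.

(** * Closed paths and free homotopy *)

Fixpoint walk (V E : choiceType) (Y : graph V E) (v : V) (s : seq E) (w : V)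
    : bool :=
  if s is e :: s' then (org Y e == v) && walk Y (term Y e) s' w else v == w.

(* A closed path is given by its base vertex and its sequence of edges; the
   base vertex is only needed to tell constant paths apart. *)
Definition closed_path (V E : choiceType) (Y : graph V E) (c : V * seq E) : bool :=
  walk Y c.1 c.2 c.1.

Inductive free_homotopic (V E : choiceType) (Y : graph V E) :
    V * seq E -> V * seq E -> Prop :=
| fh_refl c : closed_path Y c -> free_homotopic Y c c
| fh_sym c d : free_homotopic Y c d -> free_homotopic Y d c
| fh_trans c d f : free_homotopic Y c d -> free_homotopic Y d f ->
    free_homotopic Y c f
| fh_backtrack v s1 s2 e :
    closed_path Y (v, s1 ++ s2) ->
    closed_path Y (v, s1 ++ [:: e; einv Y e] ++ s2) ->
    free_homotopic Y (v, s1 ++ [:: e; einv Y e] ++ s2) (v, s1 ++ s2)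
| fh_rotate v e s :
    closed_path Y (v, e :: s) ->
    free_homotopic Y (v, e :: s) (term Y e, rcons s e).

Definition path_pow (V E : choiceType) (c : V * seq E) (k : nat) : V * seq E :=
  (c.1, flatten (nseq k c.2)).

(* Primitivity is taken up to homotopy; constant paths, being their own
   squares, are not primitive. *)
Definition primitive_path (V E : choiceType) (Y : graph V E) (c : V * seq E)
    : Prop :=
  closed_path Y c /\
  forall d k, closed_path Y d -> (2 <= k)%N -> ~ free_homotopic Y c (path_pow d k).

Definition homotopy_class (V E : choiceType) (Y : graph V E) (c : V * seq E)
    : set (V * seq E) :=
  [set d | free_homotopic Y c d].

Definition primitive_classes (V E : choiceType) (Y : graph V E)
    : set (set (V * seq E)) :=
  [set homotopy_class Y c | c in primitive_path Y].

Definition class_len (V E : choiceType) (g : set (V * seq E)) : nat :=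
  xget 0%N [set n | (exists2 c, g c & size c.2 = n) /\
                    forall d, g d -> (n <= size d.2)%N].

Definition act_path (V E : choiceType) (Y : graph V E) (a : zaction Y) (k : int)
    (c : V * seq E) : V * seq E :=
  (actV a k c.1, map (actE a k) c.2).

Definition act_class (V E : choiceType) (Y : graph V E) (a : zaction Y) (k : int)
    (g : set (V * seq E)) : set (V * seq E) :=
  act_path a k @` g.

Definition class_stab (V E : choiceType) (Y : graph V E) (a : zaction Y)
    (g : set (V * seq E)) : set int :=
  [set k | act_class a k g = g].

Definition class_orbit (V E : choiceType) (Y : graph V E) (a : zaction Y)
    (g : set (V * seq E)) : set (set (V * seq E)) :=
  [set act_class a k g | k in [set: int]].

Definition primitive_orbits (V E : choiceType) (Y : graph V E) (a : zaction Y)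
    : set (set (set (V * seq E))) :=
  [set class_orbit a g | g in primitive_classes Y].

(** * Principal branches of complex functions *)

Definition cexp (R : realType) (z : R[i]) : R[i] :=
  (expR (complex.Re z))%:C%C *
  (cos (complex.Im z) +i* sin (complex.Im z))%C.

Definition cmod (R : realType) (z : R[i]) : R :=
  Num.sqrt (complex.Re z ^+ 2 + complex.Im z ^+ 2).

(* The argument in ]-pi, pi] of a nonzero complex number. *)
Definition carg (R : realType) (z : R[i]) : R :=
  if 0 <= complex.Im z then acos (complex.Re z / cmod z)
  else - acos (complex.Re z / cmod z).

Definition clog (R : realType) (z : R[i]) : R[i] :=
  (ln (cmod z) +i* carg z)%C.

Definition cpow (R : realType) (z a : R[i]) : R[i] :=
  if z == 0 then (a == 0)%:R else cexp (a * clog z).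

Definition csqrt (R : realType) (z : R[i]) : R[i] := cpow z (2%:R^-1).

(** * The L2 zeta function *)

(* Unordered products over a possibly infinite set D: limit of the finite
   partial products along the net of finite subsets of D. *)
Definition finite_subsets (I : choiceType) (D : set I) : set_system {fset I} :=
  filter_from [set A : {fset I} | [set` A] `<=` D]
    (fun A => [set B : {fset I} | (A `<=` B)%fset /\ [set` B] `<=` D]).

Definition partial_prod (R : realType) (I : choiceType) (f : I -> R[i])
    (A : {fset I}) : R[i] :=
  \prod_(i <- A) f i.

(* If the stabilizer is infinite then the cardinal below is 0, so the exponent
   is 0, in accordance with 1 / oo = 0. *)
Definition zeta_factor (R : realType) (V E : choiceType) (Y : graph V E)
    (a : zaction Y) (u : R[i]) (g : set (V * seq E)) : R[i] :=
  cpow (1 - u ^+ class_len g) ((#|` fset_set (class_stab a g)|%fset)%:R^-1).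

(* The length and the stabilizer are constant on orbits, so the choice of the
   representative does not matter. *)
Definition zeta_orbit_factor (R : realType) (V E : choiceType) (Y : graph V E)
    (a : zaction Y) (u : R[i]) (o : set (set (V * seq E))) : R[i] :=
  zeta_factor a u (xget set0 o).

Definition zeta_partial_prods (R : realType) (V E : choiceType) (Y : graph V E)
    (a : zaction Y) (u : R[i]) : set_system R[i]^o :=
  partial_prod (zeta_orbit_factor a u) @ finite_subsets (primitive_orbits a).

(* The inverse of the L2 zeta function; meaningful when the product converges,
   i.e. when [cvg (zeta_partial_prods a u)]. *)
Definition L2zeta_inv (R : realType) (V E : choiceType) (Y : graph V E)
    (a : zaction Y) (u : R[i]) : R[i] :=
  lim (zeta_partial_prods a u).

(** * The determinant of the Laplacian *)

(* Z[u][t, 1/t] is regarded as a subring of its fraction field. *)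
Definition laurent := {fraction {poly {poly int}}}.

Definition tvar : laurent := tofrac 'X.
Definition lconst (c : {poly int}) : laurent := tofrac c%:P.
Definition uvar : laurent := lconst 'X.

Definition adjacency (V E : choiceType) (Y : graph V E) (y y' : V) : nat :=
  #|` fset_set [set e | org Y e = y /\ term Y e = y']|%fset.

Definition degree (V E : finType) (X : graph V E) (w : V) : nat :=
  #|[set e | org X e == w]%SET|.

(* Matrix of the adjacency operator over the group ring: with respect to the
   lifts [s], the image of the basis vector [s w] has coefficient
   [adjacency (t^k s v) (s w)] on the vertex t^k s v.  Only finitely many terms
   of the sum are nonzero. *)
Definition adjacency_entry (V E : choiceType) (Y : graph V E) (a : zaction Y)
    (VX : finType) (s : VX -> V) (v w : VX) : laurent :=
  \sum_(k \in [set: int]) (adjacency Y (actV a k (s v)) (s w))%:R * tvar ^ k.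

Definition adjacency_mx (V E : choiceType) (Y : graph V E) (a : zaction Y)
    (VX : finType) (s : VX -> V) : 'M[laurent]_#|VX| :=
  \matrix_(i, j) adjacency_entry a s (enum_val i) (enum_val j).

Definition Q_mx (VX EX : finType) (X : graph VX EX) : 'M[laurent]_#|VX| :=
  diag_mx (\row_i ((degree X (enum_val i))%:R - 1)).

Definition Delta_mx (VX EX : finType) (X : graph VX EX)
    (V E : choiceType) (Y : graph V E) (a : zaction Y) (s : VX -> V)
    : 'M[laurent]_#|VX| :=
  1%:M - uvar *: adjacency_mx a s + uvar ^+ 2 *: Q_mx X.

(* P_u((t + 1/t)/2), for P a polynomial in x with coefficients in Z[u]. *)
Definition eval_at_cos (P : {poly {poly int}}) : laurent :=
  (map_poly lconst P).[(tvar + tvar^-1) / 2%:R].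

(* P_u for a complex value of u. *)
Definition specialize (R : realType) (P : {poly {poly int}}) (u : R[i])
    : {poly R[i]} :=
  map_poly (fun c : {poly int} => (map_poly intr c).[u]) P.

(* Main.v *)
(** Stabilizers are trivial, so the zeta function is [prod (1 - u^len)] over the
    translation orbits of primitive cycles. Lifting the edges of [X] to edges of
    [Y] based at the chosen vertices gives each edge [e] a voltage [volt e] in
    [Z]; let [T z] be the non-backtracking edge matrix of [X] with [e] weighted
    by [z^(-volt e)]. Bass' identity reads [det (1 - u T z) = (1 - u^2)^(-chi)
    P_u((z + 1/z)/2)], and writing the roots of [P_u] as [(w + 1/w)/2] with
    [|w| > 1], the right-hand side is [c prod (1 - z/w)(1 - 1/(z w))] where [c]
    is the right-hand side of the theorem. The product over the [N]-th roots of
    unity [z] is thus [c^N prod (1 - w^-N)^2].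

    Averaging [tr (T z)^m] over the [N]-th roots of unity counts the cyclically
    reduced closed paths of length [m] in [Y] up to translation, as soon as [N]
    is large compared with [m]. Comparing logarithmic derivatives, the same
    product agrees, up to a power [u^M] with [M] proportional to [N], with the
    [N]-th power of [F_M], the product of [1 - u^len] over the orbits of length
    less than [M]. For small [u] this gives [(c / F_M)^N -> 1] for [N = M L + 1]
    and for [N = M L + 2], whence [F_M -> c]: no logarithm is needed. *)

Require Import Defs.
From HB Require Import structures.
From mathcomp Require Import all_boot all_order all_algebra fraction.
From mathcomp Require Import finmap complex.
From mathcomp Require Import boolp classical_sets cardinality fsbigop.
From mathcomp Require Import reals topology normedtype sequences exp trigo.
From mathcomp Require Import cyclic separable cyclotomic.
From mathcomp Require Import ring lra zify.
Set Implicit Arguments.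
Unset Strict Implicit.
Unset Printing Implicit Defensive.
Import Order.TTheory GRing.Theory Num.Theory.
Import numFieldNormedType.Exports.
Local Open Scope classical_set_scope.
Local Open Scope ring_scope.

(** * Matrices indexed by finite types, and their spectra *)

Section FunMatrix.
Variables (R : pzSemiRingType) (S T : finType).

Definition fun_mx (F : S -> T -> R) : 'M_(#|S|, #|T|) :=
  \matrix_(i, j) F (enum_val i) (enum_val j).

Lemma sum_enum_val (F : S -> R) : \sum_(i < #|S|) F (enum_val i) = \sum_a F a.
Proof. by rewrite (reindex _ (onW_bij _ (enum_val_bij S))). Qed.

Lemma sum_delta (a : S) (F : S -> R) : \sum_b (b == a)%:R * F b = F a.
Proof.
rewrite (bigD1 a) //= eqxx mul1r big1 ?addr0 // => b /negPf ->.
by rewrite mul0r.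
Qed.

Lemma eq_fun_mx (F G : S -> T -> R) : F =2 G -> fun_mx F = fun_mx G.
Proof. by move=> FG; apply/matrixP => i j; rewrite !mxE FG. Qed.

End FunMatrix.

Section FunMatrixAlgebra.
Variables (R : pzSemiRingType) (S T U : finType).

Lemma fun_mxM (F : S -> T -> R) (G : T -> U -> R) :
  fun_mx F *m fun_mx G = fun_mx (fun a c => \sum_b F a b * G b c).
Proof.
apply/matrixP => i j; rewrite !mxE -[RHS]sum_enum_val.
by apply: eq_bigr => k _; rewrite !mxE.
Qed.

Lemma fun_mx1 : fun_mx (fun a b : S => (a == b)%:R) = 1%:M :> 'M[R]_#|S|.
Proof. by apply/matrixP => i j; rewrite !mxE (inj_eq enum_val_inj). Qed.

Lemma mxtrace_fun_mx (F : S -> S -> R) : \tr (fun_mx F) = \sum_a F a a.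
Proof. by rewrite -[RHS]sum_enum_val; apply: eq_bigr => i _; rewrite mxE. Qed.

End FunMatrixAlgebra.

Lemma det_1sub_mulmxC (R : comNzRingType) m n
    (A : 'M[R]_(m, n)) (B : 'M_(n, m)) :
  \det (1%:M - A *m B) = \det (1%:M - B *m A).
Proof.
have lower_upper : block_mx 1%:M A B 1%:M =
    block_mx 1%:M 0 B 1%:M *m block_mx 1%:M A 0 (1%:M - B *m A) :> 'M_(m + n).
  rewrite mulmx_block !(mulmx1, mul1mx, mulmx0, mul0mx, addr0, add0r).
  by rewrite [B *m A + _]addrC subrK.
have upper_lower : block_mx 1%:M A B 1%:M =
    block_mx (1%:M - A *m B) A 0 1%:M *m block_mx 1%:M 0 B 1%:M :> 'M_(m + n).
  rewrite mulmx_block !(mulmx1, mul1mx, mulmx0, mul0mx, addr0, add0r).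
  by rewrite subrK.
have := congr1 determinant lower_upper.
rewrite {1}upper_lower !det_mulmx !det_lblock !det_ublock.
by rewrite !det1 !mul1r !mulr1.
Qed.

Lemma is_trig_mxM (R : pzSemiRingType) n (A B : 'M[R]_n) :
  is_trig_mx A -> is_trig_mx B -> is_trig_mx (A *m B).
Proof.
move=> /is_trig_mxP Atrig /is_trig_mxP Btrig.
apply/is_trig_mxP => i j lt_ij; rewrite mxE big1 // => k _.
have [lt_ik|le_ki] := ltnP i k; first by rewrite Atrig ?mul0r.
by rewrite Btrig ?mulr0 // (leq_ltn_trans le_ki).
Qed.

Lemma mulmx_trig_diag (R : pzSemiRingType) n (A B : 'M[R]_n) i :
  is_trig_mx A -> is_trig_mx B -> (A *m B) i i = A i i * B i i.
Proof.
move=> /is_trig_mxP Atrig /is_trig_mxP Btrig.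
rewrite mxE (bigD1 i) //= big1 ?addr0 // => k /negPf neq_ki.
have [lt_ik|lt_ki|/val_inj eq_ik] := ltngtP i k.
- by rewrite Atrig ?mul0r.
- by rewrite Btrig ?mulr0.
- by rewrite eq_ik eqxx in neq_ki.
Qed.

Lemma is_trig_mxX (R : pzSemiRingType) n (A : 'M[R]_n) m :
  is_trig_mx A -> is_trig_mx (A ^+ m).
Proof.
move=> Atrig; elim: m => [|m IHm]; first by rewrite expr0 scalar_mx_is_trig.
by rewrite exprS is_trig_mxM.
Qed.

Lemma exp_trig_mx_diag (R : pzSemiRingType) n (A : 'M[R]_n) m i :
  is_trig_mx A -> (A ^+ m) i i = A i i ^+ m.
Proof.
move=> Atrig; elim: m => [|m IHm]; first by rewrite !expr0 mxE eqxx.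
by rewrite !exprS mulmx_trig_diag ?is_trig_mxX // IHm.
Qed.

Lemma conjmxX (F : fieldType) n (P A : 'M[F]_n) m :
  P \in unitmx -> conjmx P (A ^+ m) = conjmx P A ^+ m.
Proof.
move=> Punit; elim: m => [|m IHm].
  by rewrite !expr0 conjmx_scalar ?row_free_unit.
by rewrite !exprS -IHm; apply: conjmxM; rewrite inE stablemx_unit.
Qed.

Section Det1SubX.
Variable R : comNzRingType.

Definition det_1subX n (A : 'M[R]_n) : {poly R} :=
  \det (1%:M - 'X *: map_mx polyC A).

Lemma horner_det_1subX n (A : 'M[R]_n) u :
  (det_1subX A).[u] = \det (1%:M - u *: A).
Proof.
rewrite -[_.[u]]/(horner_eval u _) -det_map_mx; congr (\det _).
apply/matrixP => i j; rewrite !mxE rmorphB rmorphM rmorph_nat /=.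
by rewrite /horner_eval hornerX hornerC.
Qed.

Lemma det_1subX_trig n (A : 'M[R]_n) :
  is_trig_mx A -> det_1subX A = \prod_i (1 - A i i *: 'X).
Proof.
move=> /is_trig_mxP Atrig; rewrite /det_1subX det_trig.
  by apply: eq_bigr => i _; rewrite !mxE eqxx mulrC mul_polyC.
apply/is_trig_mxP => i j lt_ij.
by rewrite !mxE Atrig // mulr0 subr0 -val_eqE /= ltn_eqF.
Qed.

End Det1SubX.

Lemma det_1subX_conjmx (F : fieldType) n (P A : 'M[F]_n) :
  P \in unitmx -> det_1subX (conjmx P A) = det_1subX A.
Proof.
move=> Punit; rewrite (conjumx A Punit) /det_1subX.
have -> : 1%:M - 'X *: map_mx polyC (P *m A *m invmx P) =
    map_mx polyC P *m (1%:M - 'X *: map_mx polyC A) *m map_mx polyC (invmx P).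
  rewrite mulmxBr mulmx1 mulmxBl -map_mxM mulmxV // map_mx1.
  by rewrite -scalemxAr -scalemxAl !map_mxM.
rewrite !det_mulmx mulrC mulrA -det_mulmx -map_mxM mulVmx //.
by rewrite map_mx1 det1 mul1r.
Qed.

Section Spectrum.
Variable C : numClosedFieldType.

Lemma trigonalizable_closed n (A : 'M[C]_n) : trigonalizable A.
Proof.
case: n A => [|n] A.
  by exists 1%:M; [exact: unitmx1 | apply/is_trig_mxP => -[]].
by have [P /unitarymx_unit] := Schur A isT; exists P.
Qed.

Lemma spectrum_exists n (A : 'M[C]_n) : exists lam : 'I_n -> C,
  [/\ det_1subX A = \prod_i (1 - lam i *: 'X),
      forall m, \tr (A ^+ m) = \sum_i lam i ^+ m
    & forall i, eigenvalue A (lam i)].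
Proof.
have [P Punit Dtrig] := trigonalizable_closed A; pose D := conjmx P A.
exists (fun i => D i i); split=> [|m|i].
- by rewrite -(det_1subX_conjmx A Punit) det_1subX_trig.
- transitivity (\tr (D ^+ m)).
    by rewrite -conjmxX // conjumx // mxtrace_mulC mulmxA mulVmx // mul1mx.
  by apply: eq_bigr => i _; rewrite exp_trig_mx_diag.
apply: (@eigenvalue_conjmx _ _ _ P); rewrite ?stablemx_unit ?row_free_unit //.
rewrite -topredE /= eigenvalue_root_char char_poly_trig //.
rewrite -(big_map (fun i => D i i) xpredT (fun a => 'X - a%:P)).
by rewrite root_prod_XsubC; apply: map_f; apply: mem_index_enum.
Qed.

End Spectrum.

Lemma norm_eigenvalue_le (F : numFieldType) n (A : 'M[F]_n) (b lam : F) :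
  (forall i j, `|A i j| <= b) -> eigenvalue A lam -> `|lam| <= n%:R * b.
Proof.
move=> Ab /eigenvalueP[v vA v_neq0].
have v_gt0 : 0 < \sum_j `|v 0 j|.
  rewrite lt_def sumr_ge0 // andbT; apply: contra v_neq0.
  rewrite psumr_eq0 // => /allP v_eq0; apply/eqP/rowP => j.
  rewrite mxE; apply/eqP; rewrite -normr_eq0.
  exact: v_eq0 (mem_index_enum j).
rewrite -(ler_pM2r v_gt0) mulr_sumr.
under eq_bigr => j _.
  rewrite -normrM; have /rowP/(_ j) := vA; rewrite !mxE => <-; over.
apply: (@le_trans _ _ (\sum_(j < n) \sum_k `|v 0 k| * b)).
  apply: ler_sum => j _; apply: (le_trans (ler_norm_sum _ _ _)).
  by apply: ler_sum => k _; rewrite normrM ler_wpM2l.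
by rewrite sumr_const card_ord -mulr_suml mulrC -[leLHS]mulr_natl mulrA.
Qed.

(** * Logarithmic derivatives modulo a power of X *)

Lemma dvdp_XnP (F : fieldType) M (p : {poly F}) :
  reflect (forall k, (k < M)%N -> p`_k = 0) ('X^M %| p).
Proof.
apply: (iffP idP) => [/dvdpP[q ->] k lt_kM|p_eq0].
  by rewrite coefMXn lt_kM.
rewrite -(poly_take_drop M p) dvdp_add ?dvdp_mulIr //.
suff -> : take_poly M p = 0 by apply: dvdp0.
by apply/polyP => k; rewrite coef_take_poly coef0; case: ltnP => // /p_eq0.
Qed.

Lemma coef_mulXderiv (R : nzRingType) (p : {poly R}) k :
  ('X * p^`())`_k = p`_k *+ k.
Proof. by rewrite coefXM; case: k => // k; rewrite coef_deriv. Qed.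

Section LogDerivative.
Variable F : numFieldType.
Implicit Types (f g s t : {poly F}) (M : nat).

(* Modulo ['X^M], the series [- s / 'X] is the logarithmic derivative of [f]. *)
Definition has_logderiv M f s := 'X^M %| 'X * f^`() + f * s.

Lemma has_logderiv1 M : has_logderiv M 1 0.
Proof. by rewrite /has_logderiv derivC !mulr0 addr0 dvdp0. Qed.

Lemma has_logderivM M f g s t :
  has_logderiv M f s -> has_logderiv M g t -> has_logderiv M (f * g) (s + t).
Proof.
rewrite /has_logderiv => f_s g_t.
have -> : 'X * (f * g)^`() + f * g * (s + t) =
   g * ('X * f^`() + f * s) + f * ('X * g^`() + g * t).
  by rewrite derivM; ring.
by rewrite dvdp_add // dvdp_mull.
Qed.

Lemma has_logderiv_prod M (I : Type) (r : seq I) (P : pred I)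
    (f s : I -> {poly F}) : (forall i, P i -> has_logderiv M (f i) (s i)) ->
  has_logderiv M (\prod_(i <- r | P i) f i) (\sum_(i <- r | P i) s i).
Proof.
move=> f_s; elim/big_rec2: _ => [|i t g Pi g_t]; first exact: has_logderiv1.
by apply: has_logderivM => //; apply: f_s.
Qed.

Lemma has_logderivX M f s k :
  has_logderiv M f s -> has_logderiv M (f ^+ k) (s *+ k).
Proof.
move=> f_s; elim: k => [|k IHk].
  by rewrite expr0 mulr0n; apply: has_logderiv1.
by rewrite exprS mulrS; apply: has_logderivM.
Qed.

Lemma eq_has_logderiv M f s t : (forall k, (k < M)%N -> s`_k = t`_k) ->
  has_logderiv M f s -> has_logderiv M f t.
Proof.
move=> eq_st f_s; rewrite /has_logderiv -(dvdp_addl _ (_ : _ %| f * (s - t))).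
  have -> : 'X * f^`() + f * t + f * (s - t) = 'X * f^`() + f * s by ring.
  exact: f_s.
by apply/dvdp_mull/dvdp_XnP => k ltkM; rewrite coefB eq_st // subrr.
Qed.

Lemma has_logderiv_1subXn M (c : F) d : (0 < d)%N ->
  has_logderiv M (1 - c *: 'X^d)
    (\poly_(k < M) if (0 < k)%N && (d %| k)%N then d%:R * c ^+ (k %/ d) else 0).
Proof.
move=> d_gt0; apply/dvdp_XnP => k lt_kM.
rewrite coefD coef_mulXderiv mulrBl mul1r !coefB -scalerAl !coefZ coefXnM.
rewrite coefC coefXn !coef_poly lt_kM (leq_ltn_trans (leq_subr d k) lt_kM).
have [/dvdnP[[|[|j]] ->]|ndvd_dk] := boolP (d %| k)%N.
- by rewrite mul0n d_gt0 mulr0n !mulr0 subrr addr0.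
- rewrite mul1n d_gt0 eqxx gtn_eqF // ltnn subnn divnn d_gt0 /= expr1.
  by rewrite mulr0 subr0 mulr1 sub0r mulNrn mulr_natl addNr.
- have -> : (j.+2 * d - d = j.+1 * d)%N by rewrite mulSn addKn.
  have lt_djd : (d < j.+2 * d)%N by rewrite ltn_Pmull.
  rewrite (gtn_eqF lt_djd) (gtn_eqF (ltn_trans d_gt0 lt_djd)).
  rewrite (ltn_trans d_gt0 lt_djd) muln_gt0 d_gt0 !mulnK // !dvdn_mull //.
  rewrite ltnNge ltnW //=.
  by rewrite mulr0 subr0 mul0rn add0r exprS mulrCA subrr.
have k_neq0 : k != 0%N by apply: contraNneq ndvd_dk => ->; apply: dvdn0.
have k_neqd : k != d by apply: contraNneq ndvd_dk => ->.
rewrite (negPf k_neq0) (negPf k_neqd) andbF mulr0 subrr mul0rn add0r sub0r.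
case: ltnP => [_|le_dk]; first by rewrite mulr0 oppr0.
by rewrite -(dvdn_addl _ (dvdnn d)) subnK // (negPf ndvd_dk) andbF mulr0 oppr0.
Qed.

(* The equation ['X * f' = - f * s] determines the coefficients of [f]
   recursively from its constant term. *)
Lemma has_logderiv_inj M f g s : f`_0 = g`_0 -> s`_0 = 0 ->
  has_logderiv M f s -> has_logderiv M g s -> 'X^M %| f - g.
Proof.
move=> eq_fg0 s0 f_s g_s.
have /dvdp_XnP fg_s : 'X^M %| 'X * (f - g)^`() + (f - g) * s.
  have -> : 'X * (f - g)^`() + (f - g) * s =
    ('X * f^`() + f * s) - ('X * g^`() + g * s) by rewrite derivB; ring.
  by rewrite dvdp_sub.
apply/dvdp_XnP; elim/ltn_ind => -[|k] IHk lt_kM.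
  by rewrite coefB eq_fg0 subrr.
have := fg_s _ lt_kM; rewrite coefD coef_mulXderiv coefM big_ord_recr /=.
rewrite subnn s0 mulr0 addr0 big1 ?addr0 => [/eqP|[i lt_ik] _ /=].
  by rewrite mulrn_eq0 /= => /eqP.
by rewrite IHk ?mul0r // (ltn_trans lt_ik).
Qed.

End LogDerivative.

(** * Weighted coefficient norms *)

Section WeightedNorm.
Variable F : numFieldType.
Implicit Types (p q : {poly F}) (rho c u : F).

Definition wnorm rho p : F := (map_poly Num.norm p).[rho].

Lemma coef_map_norm p i : (map_poly Num.norm p)`_i = `|p`_i|.
Proof. by rewrite coef_map_id0 ?normr0. Qed.

Lemma ler_horner rho p q : 0 <= rho -> (forall i, p`_i <= q`_i) ->
  p.[rho] <= q.[rho].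
Proof.
move=> rho_ge0 le_pq; pose n := maxn (size p) (size q).
rewrite (@horner_coef_wide _ n) ?leq_maxl //.
rewrite (@horner_coef_wide _ n q) ?leq_maxr //.
by apply: ler_sum => i _; rewrite ler_wpM2r ?exprn_ge0.
Qed.

Lemma wnorm_ge0 rho p : 0 <= rho -> 0 <= wnorm rho p.
Proof.
move=> rho_ge0; rewrite -(horner0 rho) ler_horner // => i.
by rewrite coef0 coef_map_norm.
Qed.

Lemma wnormB rho p q : 0 <= rho ->
  wnorm rho (p - q) <= wnorm rho p + wnorm rho q.
Proof.
move=> rho_ge0; rewrite /wnorm -hornerD ler_horner // => i.
by rewrite coefD !coef_map_norm coefB ler_normB.
Qed.

Lemma wnormM rho p q : 0 <= rho ->
  wnorm rho (p * q) <= wnorm rho p * wnorm rho q.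
Proof.
move=> rho_ge0; rewrite /wnorm -hornerM ler_horner // => i.
rewrite coef_map_norm !coefM; apply: (le_trans (ler_norm_sum _ _ _)).
by apply: ler_sum => j _; rewrite normrM !coef_map_norm.
Qed.

Lemma wnorm_monomial rho c k : wnorm rho (c *: 'X^k) = `|c| * rho ^+ k.
Proof.
rewrite /wnorm; have -> : map_poly Num.norm (c *: 'X^k) = `|c| *: 'X^k.
  by apply/polyP => i; rewrite coef_map_norm !coefZ coefXn normrM normr_nat.
by rewrite hornerZ hornerXn.
Qed.

Lemma wnorm1 rho : wnorm rho 1 = 1.
Proof.
by rewrite -[1 : {poly F}]scale1r -(expr0 'X) wnorm_monomial normr1 mulr1.
Qed.

Lemma wnorm_prod rho (I : Type) (r : seq I) (P : pred I) (p : I -> {poly F}) :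
  0 <= rho ->
  wnorm rho (\prod_(i <- r | P i) p i) <= \prod_(i <- r | P i) wnorm rho (p i).
Proof.
move=> rho_ge0; elim/big_rec2: _ => [|i y q _ le_qy]; first by rewrite wnorm1.
by apply: (le_trans (wnormM _ _ rho_ge0)); rewrite ler_wpM2l ?wnorm_ge0.
Qed.

Lemma wnormX rho p k : 0 <= rho -> wnorm rho (p ^+ k) <= wnorm rho p ^+ k.
Proof.
by move=> rho_ge0; rewrite -[k]card_ord -!prodr_const; apply: wnorm_prod.
Qed.

Lemma wnorm_1subXn_le rho c k : 0 <= rho ->
  wnorm rho (1 - c *: 'X^k) <= 1 + `|c| * rho ^+ k.
Proof.
by move=> rho_ge0; rewrite (le_trans (wnormB _ _ _)) // wnorm1 wnorm_monomial.
Qed.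

Lemma norm_horner_le rho p u : `|u| <= rho -> `|p.[u]| <= wnorm rho p.
Proof.
move=> le_u_rho; have rho_ge0 := le_trans (normr_ge0 u) le_u_rho.
rewrite horner_coef /wnorm (@horner_coef_wide _ (size p)) ?size_poly //.
apply: (le_trans (ler_norm_sum _ _ _)); apply: ler_sum => i _.
by rewrite coef_map_norm normrM normrX ler_wpM2l // lerXn2r ?nnegrE.
Qed.

Lemma norm_horner_dvd_Xn_le rho p u M : 0 < rho -> `|u| <= rho ->
  'X^M %| p -> `|p.[u]| <= (`|u| / rho) ^+ M * wnorm rho p.
Proof.
move=> rho_gt0 le_u_rho /dvdpP[q ->].
have -> : wnorm rho (q * 'X^M) = wnorm rho q * rho ^+ M.
  transitivity (map_poly Num.norm q * 'X^M).[rho];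
    last by rewrite hornerM hornerXn.
  congr _.[_]; apply/polyP => i.
  by rewrite coef_map_norm !coefMXn coef_map_norm (fun_if Num.norm) normr0.
rewrite hornerM hornerXn normrM normrX [leRHS]mulrCA -exprMn divfK ?gt_eqF //.
by rewrite ler_wpM2r ?exprn_ge0 // norm_horner_le.
Qed.

End WeightedNorm.

(** * Products close to one and geometric sums *)

Section ProductEstimates.
Variables (F : numFieldType) (I : Type).
Implicit Types (r : seq I) (x : I -> F).

Lemma prod1D_le r x : (forall i, 0 <= x i) ->
  (\prod_(i <- r) (1 + x i)) * (1 - \sum_(i <- r) x i) <= 1.
Proof.
move=> x_ge0; elim: r => [|i r IHr]; first by rewrite !big_nil subr0 mulr1.
rewrite !big_cons; apply: le_trans IHr.
set P := \prod_(j <- r) _; set S := \sum_(j <- r) _.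
have P_ge0 : 0 <= P by apply: prodr_ge0 => j _; rewrite addr_ge0.
have S_ge0 : 0 <= S by apply: sumr_ge0.
have -> : (1 + x i) * P * (1 - (x i + S)) =
          P * (1 - S) - P * (x i ^+ 2 + x i * S) by ring.
by rewrite gerBl mulr_ge0 // addr_ge0 // ?exprn_ge0 // mulr_ge0.
Qed.

Lemma prod1D_le_half r x : (forall i, 0 <= x i) ->
  \sum_(i <- r) x i <= 2^-1 ->
  \prod_(i <- r) (1 + x i) <= 1 + 2 * \sum_(i <- r) x i.
Proof.
move=> x_ge0; have := prod1D_le r x_ge0.
set P := \prod_(j <- r) _; set S := \sum_(j <- r) _ => PS_le1 S_le.
have S_ge0 : 0 <= S by apply: sumr_ge0.
have S_lt1 : 0 < 1 - S.
  by rewrite subr_gt0 (le_lt_trans S_le) // invf_lt1 ?ltr1n.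
move: PS_le1; rewrite -ler_pdivlMr // => /le_trans -> //.
rewrite ler_pdivrMr // -subr_ge0.
have -> : (1 + 2 * S) * (1 - S) - 1 = 2 * S * (2^-1 - S) by field.
by rewrite mulr_ge0 ?mulr_ge0 // subr_ge0.
Qed.

Lemma norm_prod1B_ge r x : \sum_(i <- r) `|x i| <= 1 ->
  1 - \sum_(i <- r) `|x i| <= `|\prod_(i <- r) (1 - x i)|.
Proof.
elim: r => [|i r IHr]; first by rewrite !big_nil subr0 normr1.
rewrite !big_cons; set S := \sum_(j <- r) _ in IHr * => xS_le1.
have S_ge0 : 0 <= S by apply: sumr_ge0.
have S_le1 : S <= 1 by apply: le_trans xS_le1; rewrite lerDr.
have x_le1 : `|x i| <= 1 by apply: le_trans xS_le1; rewrite lerDl.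
rewrite normrM; apply: (@le_trans _ _ ((1 - `|x i|) * (1 - S))).
  have -> : (1 - `|x i|) * (1 - S) = 1 - (`|x i| + S) + `|x i| * S by ring.
  by rewrite lerDl mulr_ge0.
apply: ler_pM; rewrite ?subr_ge0 ?IHr //.
by rewrite -{1}(normr1 F) lerB_dist.
Qed.

Lemma norm_prod1B_sub1_le r x :
  `|\prod_(i <- r) (1 - x i) - 1| <= \prod_(i <- r) (1 + `|x i|) - 1.
Proof.
elim: r => [|i r IHr]; first by rewrite !big_nil subrr normr0.
rewrite !big_cons; set P := \prod_(j <- r) (1 - _) in IHr *.
set S := \prod_(j <- r) _ in IHr *.
have -> : (1 - x i) * P - 1 = (1 - x i) * (P - 1) - x i by ring.
have -> : (1 + `|x i|) * S - 1 = (1 + `|x i|) * (S - 1) + `|x i| by ring.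
apply: (le_trans (ler_normB _ _)); rewrite lerD2r normrM.
apply: ler_pM => //; apply: (le_trans (ler_normB _ _)).
by rewrite normr1.
Qed.

Lemma norm_prod1B_sub1_le_half r x : \sum_(i <- r) `|x i| <= 2^-1 ->
  `|\prod_(i <- r) (1 - x i) - 1| <= 2 * \sum_(i <- r) `|x i|.
Proof.
move=> sum_le; apply: (le_trans (norm_prod1B_sub1_le _ _)).
by rewrite lerBlDl; apply: prod1D_le_half.
Qed.

End ProductEstimates.

Lemma geometric_tail_le (F : numFieldType) (q : F) m n : 0 <= q -> q < 1 ->
  \sum_(m <= d < n) q ^+ d <= q ^+ m / (1 - q).
Proof.
move=> q_ge0 q_lt1; have q1_gt0 : 0 < 1 - q by rewrite subr_gt0.
have [le_nm|/ltnW le_mn] := leqP n m.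
  by rewrite big_geq // divr_ge0 ?exprn_ge0 // ltW.
rewrite -(subnKC le_mn) geometric_partial_tail geometric_seriesE ?lt_eqF //=.
by rewrite ler_wpM2r ?invr_ge0 ?(ltW q1_gt0) // ler_piMr ?gerBl ?exprn_ge0.
Qed.

Lemma sum_expr_len_le (F : numFieldType) (O : eqType) (len : O -> nat)
    (b m : nat) (x : F) (s : seq O) :
  (forall d, (m <= d)%N -> (count (fun o => len o == d) s <= b ^ d)%N) ->
  0 <= x -> b%:R * x < 1 ->
  \sum_(o <- s | (m <= len o)%N) x ^+ len o <= (b%:R * x) ^+ m / (1 - b%:R * x).
Proof.
move=> count_le x_ge0 bx_lt1; pose n := (\max_(o <- s) len o).+1.
have lt_len o : o \in s -> (len o < n)%N.
  by move=> so; rewrite ltnS leq_bigmax_seq.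
apply: (le_trans _ (geometric_tail_le m n (mulr_ge0 (ler0n _ b) x_ge0) bx_lt1)).
rewrite big_seq_cond.
rewrite (eq_bigr (fun o => \sum_(m <= d < n) (len o == d)%:R * x ^+ d));
  last first.
  move=> o /andP[so le_mo]; rewrite (bigD1_seq (len o)) ?iota_uniq //=;
    last first.
    by rewrite mem_index_iota le_mo lt_len.
  rewrite eqxx mul1r big1 ?addr0 // => d /negPf.
  by rewrite eq_sym => ->; rewrite mul0r.
rewrite exchange_big /= !(big_nat _ _ m n); apply: ler_sum => d /andP[le_md _].
rewrite -mulr_suml exprMn ler_wpM2r ?exprn_ge0 // -natr_sum -natrX ler_nat.
apply: leq_trans (count_le d le_md); rewrite -big_seq_cond -sum1_count.
rewrite [leqLHS]big_mkcond [leqRHS]big_mkcond /=; apply: leq_sum => o _.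
by case: eqP => // _; case: ifP.
Qed.

(** * Limits of sequences and of unordered products *)

Section SequenceLimits.
Variable F : numFieldType.
Implicit Types (f g : nat -> F) (x : F).

Lemma cvg_norm_sub_le f g x :
  (forall n, `|f n - x| <= g n) -> g @ \oo --> (0 : F) -> f @ \oo --> x.
Proof.
move=> le_fg /cvgrPdist_lt g0; apply/cvgrPdist_lt => e /g0.
apply: filterS => n; rewrite sub0r normrN distrC; apply: le_lt_trans.
by rewrite (le_trans (le_fg n)) // ger0_norm // (le_trans _ (le_fg n)).
Qed.

Lemma cvg_ratio_of_powers f (N : nat -> nat) :
  f n ^+ N n @[n --> \oo] --> (1 : F) ->
  f n ^+ (N n).+1 @[n --> \oo] --> (1 : F) -> f @ \oo --> (1 : F).
Proof.
move=> fN1 fSN1.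
have ratio1 : f n ^+ (N n).+1 / f n ^+ N n @[n --> \oo] --> (1 : F).
  rewrite -[X in _ --> X](divr1 1); apply: cvgM fSN1 _.
  exact: cvgV (oner_neq0 _) fN1.
apply: (cvg_trans _ ratio1); apply: near_eq_cvg.
near=> n; rewrite exprS mulfK //; near: n.
exact: cvgr_neq0 fN1 (oner_neq0 _).
Unshelve. all: by end_near. Qed.

Lemma cvg_prod1 (I : Type) (r : seq I) (f : I -> nat -> F) :
  (forall i, f i @ \oo --> (1 : F)) ->
  \prod_(i <- r) f i n @[n --> \oo] --> (1 : F).
Proof.
move=> f1; elim: r => [|i r IHr].
  by under eq_fun do rewrite big_nil; apply: cvg_cst.
rewrite -[X in _ --> X](mulr1 1); under eq_fun do rewrite big_cons.
exact: cvgM.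
Qed.

Lemma cvg_prod_1subXn_sqr (I : Type) (r : seq I) (x : I -> F) :
  (forall i, x i ^+ n @[n --> \oo] --> (0 : F)) ->
  \prod_(i <- r) (1 - x i ^+ n) ^+ 2 @[n --> \oo] --> (1 : F).
Proof.
move=> x0; apply: cvg_prod1 => i.
have x1 : 1 - x i ^+ n @[n --> \oo] --> (1 : F).
  by rewrite -[X in _ --> X]subr0; apply: cvgB => //; apply: cvg_cst.
rewrite -[X in _ --> X](mulr1 1); under eq_fun do rewrite expr2.
exact: cvgM.
Qed.

End SequenceLimits.

Lemma cvg_affine_index L j : (0 < L)%N ->
  (n * L + j)%N @[n --> \oo] --> \oo.
Proof.
move=> L_gt0; apply/cvgnyPge => A; exists A => // n /= le_An.
by rewrite (leq_trans le_An) // (leq_trans (leq_pmulr n L_gt0)) ?leq_addr.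
Qed.

(* [c] is recovered from the two powers [(c / f M) ^ N] with [N = M L + 1] and
   [N = M L + 2], which avoids any choice of [N]-th roots. *)
Section PowerApproximation.
Variables (F : numFieldType) (c : F) (f g : nat -> F).
Variables (L : nat) (delta A kappa B : F).
Hypotheses (c_neq0 : c != 0) (g1 : g @ \oo --> (1 : F)) (L_gt0 : (0 < L)%N).
Hypotheses (delta_gt0 : 0 < delta) (f_ge : forall M, delta <= `|f M|).
Hypothesis approx : forall M N, (0 < N)%N -> (M * L <= N)%N ->
  `|c ^+ N * g N - f M ^+ N| <= A * kappa ^+ M * B ^+ N.
Hypothesis small : (kappa * (B / delta) ^+ L) ^+ M @[M --> \oo] --> (0 : F).

Let f_neq0 M : f M != 0.
Proof. by rewrite -normr_gt0 (lt_le_trans delta_gt0). Qed.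

Lemma cvg_scaled_power_ratio j : (0 < j)%N ->
  (c / f M) ^+ (M * L + j) * g (M * L + j)%N @[M --> \oo] --> (1 : F).
Proof.
move=> j_gt0; pose D := A * (B / delta) ^+ j.
apply: (@cvg_norm_sub_le _ _ (fun M => D * (kappa * (B / delta) ^+ L) ^+ M)) =>
  [M|].
  have N_gt0 : (0 < M * L + j)%N by rewrite addn_gt0 j_gt0 orbT.
  have := approx N_gt0 (leq_addr j (M * L)); set N := (_ + j)%N => approxN.
  have -> : (c / f M) ^+ N * g N - 1 = (c ^+ N * g N - f M ^+ N) / f M ^+ N.
    by rewrite expr_div_n mulrBl divff ?expf_neq0 // mulrAC.
  have -> : D * (kappa * (B / delta) ^+ L) ^+ M =
      A * kappa ^+ M * B ^+ N / delta ^+ N.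
    rewrite /D -[RHS]mulrA -expr_div_n exprD mulnC exprM
      [(kappa * _) ^+ M]exprMn.
    by ring.
  rewrite normrM normfV normrX ler_pM ?invr_ge0 ?exprn_ge0 //.
  rewrite lef_pV2 ?posrE ?exprn_gt0 ?normr_gt0 //.
  by rewrite lerXn2r ?nnegrE // ltW.
by rewrite -[X in _ --> X](mulr0 D); apply: cvgM => //; apply: cvg_cst.
Qed.

Lemma cvg_power_ratio j : (0 < j)%N ->
  (c / f M) ^+ (M * L + j) @[M --> \oo] --> (1 : F).
Proof.
move=> j_gt0; have g1j := cvg_comp _ _ (cvg_affine_index j L_gt0) g1.
have : (c / f M) ^+ (M * L + j) * g (M * L + j)%N / g (M * L + j)%N
    @[M --> \oo] --> (1 : F).
  rewrite -[X in _ --> X](divr1 1).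
  exact: cvgM (cvg_scaled_power_ratio j_gt0) (cvgV (oner_neq0 _) g1j).
apply: (cvg_trans _); apply: near_eq_cvg.
near=> M; rewrite mulfK //; near: M.
exact: cvgr_neq0 g1j (oner_neq0 _).
Unshelve. all: by end_near. Qed.

Lemma cvg_of_power_approx : f @ \oo --> c.
Proof.
have ratio1 : c / f M @[M --> \oo] --> (1 : F).
  apply: (cvg_ratio_of_powers (N := fun M => (M * L + 1)%N)).
    exact: cvg_power_ratio.
  by under eq_fun do rewrite -addnS; apply: cvg_power_ratio.
have -> : f = (fun M => c / (c / f M)).
  by apply/funext => M; rewrite invf_div mulrC divfK.
rewrite -[X in _ --> X]divr1; apply: cvgM; first exact: cvg_cst.
exact: cvgV (oner_neq0 _) ratio1.
Qed.

End PowerApproximation.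

Lemma cvg_expr_complex (R : realType) (q : R[i]) :
  `|q| < 1 -> (q ^+ n : R[i]^o) @[n --> \oo] --> (0 : R[i]^o).
Proof.
pose r := complex.Re `|q|; have normE : `|q| = r%:C%C.
  by rewrite RRe_real // normr_real.
have r_ge0 : 0 <= r by rewrite -lecR -normE normr_ge0.
rewrite normE -[1]/(1%:C%C) ltcR -{1}(ger0_norm r_ge0).
move=> /cvg_expr/cvgrPdist_lt q0; apply/cvgrPdist_lt => e e_gt0.
have eE : e = (complex.Re e)%:C%C by rewrite RRe_real // gtr0_real.
have /q0 : 0 < complex.Re e by rewrite -ltcR -eE.
apply: filterS => n; rewrite /= !sub0r !normrN !normrX (ger0_norm r_ge0).
by rewrite -ltcR rmorphXn /= -normE -eE.
Qed.

Section UnorderedProducts.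
Variables (R : realType) (I : choiceType) (D : set I).

Lemma finite_subsets_proper : ProperFilter (finite_subsets D).
Proof.
apply: filter_from_proper; last by move=> A AD; exists A; split.
apply: filter_from_filter; first by exists fset0 => x.
move=> A A' AD A'D; exists (A `|` A')%fset.
  by move=> x /=; rewrite inE => /orP[/AD|/A'D].
move=> B [AUA'B BD]; split; split=> //; apply: fsubset_trans AUA'B.
  exact: fsubsetUl.
exact: fsubsetUr.
Qed.

Lemma cvg_partial_prod_1sub (f x : I -> R[i]) (A : nat -> {fset I})
    (t : nat -> R[i]) (c : R[i]) :
  (forall i, D i -> f i = 1 - x i) ->
  (forall M, [set` A M] `<=` D) ->
  (forall M (B : {fset I}), [set` B] `<=` D ->
    {in B, forall i, i \notin A M} -> \sum_(i <- B) `|x i| <= t M) ->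
  (t : nat -> R[i]^o) @ \oo --> (0 : R[i]^o) ->
  (\prod_(i <- A M) (1 - x i) : R[i]^o) @[M --> \oo] --> (c : R[i]^o) ->
  (partial_prod f : {fset I} -> R[i]^o) @ finite_subsets D --> (c : R[i]^o).
Proof.
have finite_subsetsF := finite_subsets_proper.
move=> fE AD tail_le t0 head_c; apply/cvgrPdist_lt => e e_gt0.
pose F M := \prod_(i <- A M) (1 - x i).
have t_ge0 M : 0 <= t M by have := tail_le M fset0; rewrite big_nil; apply.
have [M [dist_M F_M t_M tF_M]] : exists M, [/\ `|c - F M| < e / 2,
    `|F M| < `|c| + 1, `|t M| < 2^-1 & `|t M| < e / 2 / (2 * (`|c| + 1))].
  near \oo => M; exists M; split; near: M.
  - by apply: (cvgr_dist_lt _ _ head_c); rewrite divr_gt0.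
  - by apply: (cvgr_norm_lt _ head_c); rewrite ltrDl.
  - by apply: (cvgr0_norm_lt _ t0); rewrite invr_gt0.
  - by apply: (cvgr0_norm_lt _ t0); rewrite !divr_gt0 ?mulr_gt0 ?ltr_wpDl.
exists (A M) => [|B [AB BD]]; first exact: AD.
pose T := [fset i in B | i \notin A M]%fset.
have T_le : \sum_(i <- T) `|x i| <= t M.
  by apply: tail_le => i; rewrite /= !inE => /andP[] // /BD.
have T_half : \sum_(i <- T) `|x i| <= 2^-1.
  by rewrite (le_trans T_le) // -(ger0_norm (t_ge0 M)) ltW.
have -> : partial_prod f B = F M * \prod_(i <- T) (1 - x i).
  rewrite /partial_prod (eq_big_seq (fun i => 1 - x i)) => [|i /BD /fE //].
  rewrite (big_fsetID _ (mem (A M))) /=.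
  suff -> : [fset i in B | i \in A M]%fset = A M by [].
  apply/fsetP => i; rewrite !inE andbC.
  by case: (boolP (i \in A M)) => // /(fsubsetP AB).
set P := \prod_(i <- T) _.
have -> : c - F M * P = (c - F M) - F M * (P - 1) by ring.
apply: (le_lt_trans (ler_normB _ _)); rewrite [e]splitr ltrD // normrM.
have P_le :=
  le_trans (norm_prod1B_sub1_le_half T_half) (ler_wpM2l (ler0n _ 2) T_le).
apply: (@le_lt_trans _ _ ((`|c| + 1) * (2 * t M))).
  by apply: ler_pM => //; rewrite ltW.
have -> : (`|c| + 1) * (2 * t M) = t M * (2 * (`|c| + 1)) by ring.
by rewrite -ltr_pdivlMr ?mulr_gt0 ?ltr_wpDl // -(ger0_norm (t_ge0 M)).
Unshelve. all: by end_near. Qed.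

End UnorderedProducts.

Lemma norm_lower_bound (R : realType) (s : seq R[i]) : exists2 d : R, 0 < d &
  forall z, z \in s -> z != 0 -> d%:C%C <= `|z|.
Proof.
elim: s => [|z s [d d_gt0 d_le]]; first by exists 1.
have [->|z_neq0] := eqVneq z 0.
  by exists d => // z'; rewrite inE => /predU1P[->|/d_le //]; rewrite eqxx.
have normE : `|z| = (complex.Re `|z|)%:C%C by rewrite RRe_real // normr_real.
exists (Num.min d (complex.Re `|z|)) => [|z'].
  by rewrite lt_min d_gt0 -ltcR -normE normr_gt0.
rewrite inE => /predU1P[-> _|z's z'_neq0].
  by rewrite [leRHS]normE lecR ge_min lexx orbT.
by apply: le_trans (d_le _ z's z'_neq0); rewrite lecR ge_min lexx.
Qed.

Lemma poly_neq0_near0 (R : realType) (p : {poly R[i]}) : p != 0 ->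
  exists2 d : R, 0 < d &
    forall u : R[i], 0 < `|u| -> `|u| < d%:C%C -> p.[u] != 0.
Proof.
move=> p_neq0; have [rs pE] := closed_field_poly_normal p.
have [d d_gt0 d_le] := norm_lower_bound rs; exists d => // u u_neq0 lt_ud.
rewrite pE hornerZ mulf_neq0 ?lead_coef_eq0 // horner_prod prodf_seq_neq0.
apply/allP => z rs_z /=; rewrite !hornerE subr_eq0.
apply: contraTneq lt_ud => uz; rewrite uz normr_gt0 in u_neq0 *.
by rewrite -real_leNgt ?normr_real ?complex_real // d_le.
Qed.

(** * Bass' identity *)

Lemma eigenvalue_involution (F : fieldType) n (A : 'M[F]_n) (lam : F) :
  A *m A = 1%:M -> eigenvalue A lam -> (lam == 1) || (lam == -1).
Proof.
move=> AA1 /eigenvalueP[v vA v_neq0]; rewrite -sqrf_eq1.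
have /eqP : v *m (A *m A) = lam ^+ 2 *: v.
  by rewrite mulmxA vA -scalemxAl vA scalerA.
rewrite AA1 mulmx1 -subr_eq0 -[X in X - _]scale1r -scalerBl scaler_eq0.
by rewrite (negPf v_neq0) orbF subr_eq0 eq_sym.
Qed.

Lemma det_1add_involution (C : numClosedFieldType) n (A : 'M[C]_n) u :
  A *m A = 1%:M -> \tr A = 0 -> \det (1%:M + u *: A) = (1 - u ^+ 2) ^+ n./2.
Proof.
move=> AA1 trA0; have [lam [detA trA eigA]] := spectrum_exists A.
have lamN i : lam i != 1 -> lam i = -1.
  by have /orP[->|/eqP] := eigenvalue_involution AA1 (eigA i).
pose plus := #|[pred i | lam i == 1]|; pose minus := #|[pred i | lam i != 1]|.
have plusDminus : (plus + minus = n)%N.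
  by rewrite -[RHS]card_ord -(cardC [pred i | lam i == 1]).
have eq_plus_minus : plus = minus.
  have : \sum_i lam i = 0.
    transitivity (\sum_i lam i ^+ 1); last by rewrite -trA expr1.
    by apply: eq_bigr => i _; rewrite expr1.
  rewrite (bigID (fun i => lam i == 1)) /= (eq_bigr (fun=> 1)) => [|i /eqP //].
  rewrite [X in _ + X](eq_bigr (fun=> -1)) => [|i /lamN //].
  by rewrite !sumr_const mulNrn => /eqP; rewrite subr_eq0 eqr_nat => /eqP.
have -> : 1%:M + u *: A = 1%:M - (- u) *: A by rewrite scaleNr opprK.
rewrite -horner_det_1subX detA horner_prod (bigID (fun i => lam i == 1)) /=.
rewrite (eq_bigr (fun=> 1 + u)) => [|i /eqP ->]; last by rewrite !hornerE; ring.
rewrite [X in _ * X](eq_bigr (fun=> 1 - u)) => [|i /lamN ->]; last first.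
  by rewrite !hornerE; ring.
rewrite !prodr_const -/plus -/minus -plusDminus eq_plus_minus addnn doubleK.
by rewrite -exprMn; congr (_ ^+ _); ring.
Qed.

Definition nonback (V E : choiceType) (Y : graph V E) (e f : E) : bool :=
  (term Y e == org Y f) && (f != einv Y e).

Lemma term_einv (V E : choiceType) (Y : graph V E) e :
  term Y (einv Y e) = org Y e.
Proof. by rewrite /term einvK. Qed.

Section EdgeMatrix.
Variables (R : comNzRingType) (VX EX : finType) (X : graph VX EX) (x : EX -> R).

Definition edge_mx : 'M[R]_#|EX| :=
  fun_mx (fun e f => (nonback X e f)%:R * x f).

Definition weighted_adjacency (v w : VX) : R :=
  \sum_(e | (org X e == v) && (term X e == w)) x e.

Definition weighted_Delta (u : R) : 'M[R]_#|VX| :=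
  1%:M - u *: fun_mx weighted_adjacency
  + u ^+ 2 *: diag_mx (\row_i ((degree X (enum_val i))%:R - 1)).

Definition org_mx : 'M[R]_(#|VX|, #|EX|) :=
  fun_mx (fun v e => (v == org X e)%:R * x e).

Definition term_mx : 'M[R]_(#|EX|, #|VX|) :=
  fun_mx (fun e v => (v == term X e)%:R).

Definition reversal_mx : 'M[R]_#|EX| :=
  fun_mx (fun e f => (f == einv X e)%:R * x f).

Lemma edge_mxE : edge_mx = term_mx *m org_mx - reversal_mx.
Proof.
rewrite fun_mxM; apply/matrixP => i j; rewrite !mxE sum_delta -mulrBl.
congr (_ * _); rewrite /nonback.
have [->|] := eqVneq (enum_val j) (einv X (enum_val i)).
  by rewrite andbF /term eqxx subrr.
by rewrite andbT subr0.
Qed.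

Lemma org_term_mx : org_mx *m term_mx = fun_mx weighted_adjacency.
Proof.
rewrite fun_mxM; apply: eq_fun_mx => v w; rewrite [RHS]big_mkcond.
apply: eq_bigr => e _; rewrite [v == _]eq_sym [w == _]eq_sym.
by do 2 case: eqP => _ /=; rewrite ?mul0r ?mulr0 ?mul1r ?mulr1.
Qed.

Lemma mxtrace_reversal_mx : \tr reversal_mx = 0.
Proof.
rewrite mxtrace_fun_mx big1 // => e _.
by rewrite eq_sym (negPf (einv_neq X _)) mul0r.
Qed.

Hypothesis weight_einv : forall e, x e * x (einv X e) = 1.

Lemma reversal_mxK : reversal_mx *m reversal_mx = 1%:M.
Proof.
rewrite fun_mxM -fun_mx1; apply: eq_fun_mx => e f.
under eq_bigr do rewrite -mulrA.
rewrite sum_delta einvK eq_sym; case: eqVneq => [->|_].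
  by rewrite mul1r mulrC weight_einv.
by rewrite mul0r mulr0.
Qed.

Lemma org_reversal_term_mx :
  org_mx *m reversal_mx *m term_mx =
  diag_mx (\row_i (degree X (enum_val i))%:R).
Proof.
rewrite -mulmxA [reversal_mx *m _]fun_mxM fun_mxM; apply/matrixP => i j.
rewrite !mxE -[i == j](inj_eq enum_val_inj) /degree -sum1dep_card natr_sum.
move: (enum_val i) (enum_val j) => v w.
rewrite -sumrMnl [RHS]big_mkcond; apply: eq_bigr => e _.
under eq_bigr do rewrite -mulrA.
rewrite sum_delta term_einv mulrA -[_ * x e * _]mulrA weight_einv mulr1.
rewrite [org X e == v]eq_sym [w == _]eq_sym.
by case: eqVneq => [->|_]; rewrite ?mul0r ?mul1r.
Qed.

End EdgeMatrix.

Theorem bass_identity (C : numClosedFieldType) (VX EX : finType)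
    (X : graph VX EX) (x : EX -> C) (u : C) :
  (forall e, x e * x (einv X e) = 1) -> 1 - u ^+ 2 != 0 ->
  \det (1%:M - u *: edge_mx X x) * (1 - u ^+ 2) ^+ #|VX| =
  (1 - u ^+ 2) ^+ #|EX|./2 * \det (weighted_Delta X x u).
Proof.
move=> weight_einv; set q := 1 - u ^+ 2 => q_neq0.
pose J := reversal_mx X x; have JJ : J *m J = 1%:M := reversal_mxK weight_einv.
pose K := q^-1 *: (1%:M - u *: J).
have JK : (1%:M + u *: J) *m K = 1%:M.
  rewrite -scalemxAr mulmxDl !mulmxBr !mulmx1 !mul1mx -!scalemxAl -!scalemxAr.
  rewrite JJ addrA subrK scalerA -expr2 -[X in X - _]scale1r -scalerBl -/q.
  by rewrite scalerA mulVf // scale1r.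
have -> : 1%:M - u *: edge_mx X x =
    (1%:M + u *: J) *m (1%:M - (u *: (K *m term_mx _ X)) *m org_mx X x).
  rewrite mulmxBr mulmx1 -scalemxAl -scalemxAr !mulmxA JK mul1mx edge_mxE.
  by rewrite scalerBr opprB addrA addrAC.
rewrite det_mulmx det_1add_involution ?mxtrace_reversal_mx // -/q.
rewrite det_1sub_mulmxC -mulrA; congr (_ * _).
have -> : 1%:M - org_mx X x *m (u *: (K *m term_mx _ X)) =
    q^-1 *: weighted_Delta X x u.
  rewrite -scalemxAr mulmxA /K -scalemxAr mulmxBr mulmx1 -scalemxAr -scalemxAl.
  rewrite mulmxBl -scalemxAl org_reversal_term_mx // org_term_mx.
  rewrite -[1%:M in LHS](scalerK q_neq0) scalerA [u * _]mulrC -scalerA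
    -scalerBr.
  congr (_ *: _); apply/matrixP => i j; rewrite !mxE.
  by case: eqP => _ /=; rewrite /q ?mulr1n ?mulr0n; ring.
by rewrite detZ exprVn mulrAC mulVf ?mul1r // expf_neq0.
Qed.

(** * Traces of powers of the edge matrix *)

Section EdgeMatrixTrace.
Variables (R : comNzRingType) (VX EX : finType) (X : graph VX EX) (x : EX -> R).

Lemma sum_tuple_cons m (G : m.+1.-tuple EX -> R) :
  \sum_w G w = \sum_e \sum_(w : m.-tuple EX) G [tuple of e :: w].
Proof.
rewrite pair_big /=.
rewrite (reindex (fun ew : EX * m.-tuple EX => [tuple of ew.1 :: ew.2])) //=.
exists (fun w => (thead w, [tuple of behead w])) => [[e w] _|w _] /=.
  by rewrite theadE; congr pair; apply: val_inj.
by rewrite [RHS]tuple_eta.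
Qed.

Lemma edge_mxX m : edge_mx X x ^+ m = fun_mx (fun e f => \sum_(w : m.-tuple EX)
  (path (nonback X) e w && (last e w == f))%:R * \prod_(g <- w) x g).
Proof.
elim: m => [|m IHm].
  rewrite expr0 -[1]fun_mx1; apply: eq_fun_mx => e f.
  rewrite (bigD1 [tuple]) //= big_nil mulr1 big1 ?addr0 // => w /eqP[].
  by rewrite [w]tuple0 [RHS]tuple0.
rewrite exprS IHm [LHS]fun_mxM; apply: eq_fun_mx => e f.
rewrite sum_tuple_cons; apply: eq_bigr => g _; rewrite mulr_sumr.
apply: eq_bigr => w _ /=; rewrite big_cons.
by case: (nonback X _ _) => /=; rewrite ?mul0r // mul1r mulrCA.
Qed.

Lemma mxtrace_edge_mxX m : (0 < m)%N -> \tr (edge_mx X x ^+ m) =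
  \sum_(w : m.-tuple EX) (cycle (nonback X) w)%:R * \prod_(e <- w) x e.
Proof.
case: m => // m _; rewrite edge_mxX mxtrace_fun_mx exchange_big /=.
apply: eq_bigr => w _; rewrite -mulr_suml; congr (_ * _).
case: w => -[|g w] //= _.
rewrite (eq_bigr
  (fun f => (f == last g w)%:R * (path (nonback X) f (g :: w))%:R)).
  rewrite sum_delta -[path _ _ (rcons _ _)]/(cycle (nonback X) (g :: w)).
  by rewrite (cycle_path g).
by move=> f _; rewrite -natrM mulnb andbC eq_sym.
Qed.

End EdgeMatrixTrace.

(** * Rotations and powers of words *)

Section RotationsPowers.
Variable E : eqType.
Implicit Types (s t w : seq E) (e f : E).

Definition roteq s t := exists i, t = rot i s.

Lemma roteq_refl s : roteq s s.
Proof. by exists 0; rewrite rot0. Qed.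

Lemma roteq_rot i s : roteq s (rot i s).
Proof. by exists i. Qed.

Lemma rot_bounded i s : exists2 j, (j <= size s)%N & rot i s = rot j s.
Proof.
have [le_is|lt_si] := leqP i (size s); first by exists i.
by exists 0; rewrite // rot0 rot_oversize // ltnW.
Qed.

Lemma rot_bounded_lt i s : s != [::] ->
  exists2 j, (j < size s)%N & rot i s = rot j s.
Proof.
rewrite -size_eq0 -lt0n => s_gt0; have [j le_js ->] := rot_bounded i s.
have [eq_js|neq_js] := eqVneq j (size s); last first.
  by exists j; rewrite // ltn_neqAle neq_js.
by exists 0; rewrite // rot0 eq_js rot_size.
Qed.

Lemma roteq_sym s t : roteq s t -> roteq t s.
Proof.
move=> [i ->]; have [j le_js ->] := rot_bounded i s.
by exists (size (rot j s) - j)%N; rewrite -/(rotr j (rot j s)) rotK.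
Qed.

Lemma roteq_trans s t w : roteq s t -> roteq t w -> roteq s w.
Proof.
move=> [i ->] [j ->]; have [i' le_i's ->] := rot_bounded i s.
have [j'] := rot_bounded j (rot i' s); rewrite size_rot => le_j's ->.
by rewrite rot_add_mod //; eexists.
Qed.

Lemma roteq_size s t : roteq s t -> size s = size t.
Proof. by move=> [i ->]; rewrite size_rot. Qed.

Definition word_pow s k : seq E := flatten (nseq k s).

Lemma word_powS s k : word_pow s k.+1 = s ++ word_pow s k.
Proof. by []. Qed.

Lemma size_word_pow s k : size (word_pow s k) = (k * size s)%N.
Proof. by elim: k => // k IHk; rewrite word_powS size_cat IHk mulSn. Qed.

Lemma word_pow1 s : word_pow s 1 = s.
Proof. by rewrite word_powS cats0. Qed.

Lemma word_powD s i j : word_pow s (i + j) = word_pow s i ++ word_pow s j.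
Proof. by elim: i => // i IHi; rewrite addSn !word_powS IHi catA. Qed.

Lemma word_powM s i j : word_pow (word_pow s i) j = word_pow s (j * i).
Proof. by elim: j => // j IHj; rewrite mulSn word_powD word_powS IHj. Qed.

Lemma word_pow_catC s t k :
  word_pow (s ++ t) k ++ s = s ++ word_pow (t ++ s) k.
Proof.
elim: k => [|k IHk]; first by rewrite cats0.
by rewrite !word_powS -!catA IHk.
Qed.

Lemma rot1_word_pow s k : rot 1 (word_pow s k) = word_pow (rot 1 s) k.
Proof.
case: s k => [|e s] [|k] //; first by elim: k.
rewrite word_powS cat_cons !rot1_cons -!cats1 -catA -[e :: s]/([:: e] ++ s).
by rewrite word_pow_catC catA.
Qed.

Lemma roteq_word_pow s t k :
  roteq (word_pow s k) t -> exists2 s', roteq s s' & t = word_pow s' k.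
Proof.
move=> [i ->]; elim: i => [|i [s' ss' IHi]].
  by exists s; [exact: roteq_refl | rewrite rot0].
have [le_size|lt_size] := leqP (size (word_pow s k)) i.
  exists s; first exact: roteq_refl.
  by rewrite rot_oversize // ltnW.
exists (rot 1 s'); first exact: roteq_trans ss' (roteq_rot 1 s').
by rewrite -rot1_word_pow -IHi rotS.
Qed.

Lemma cycle_word_pow (r : rel E) s k : (0 < k)%N ->
  cycle r (word_pow s k) = cycle r s.
Proof.
case: k => // k _; case: s => [|e s]; first by elim: k.
have last_pow x j : last x (word_pow (e :: s) j.+1) = last e s.
  by elim: j x => [|j IHj] x; rewrite word_powS ?cats0 // last_cat IHj.
rewrite !(cycle_path e) last_pow [last e (e :: s)]/=.
elim: k => [|k IHk]; first by rewrite word_powS cats0.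
by rewrite word_powS cat_path IHk andbb.
Qed.

End RotationsPowers.

Lemma roteq_map (T T' : eqType) (h : T -> T') s t :
  roteq s t -> roteq (map h s) (map h t).
Proof. by move=> [i ->]; exists i; rewrite map_rot. Qed.

(** * Free and cyclic reduction *)

Section FreeReduction.
Variables (E : eqType) (inv : E -> E).
Hypotheses (invK : involutive inv) (inv_neq : forall e, inv e != e).
Implicit Types (s t w : seq E) (e f : E).

Definition no_backtrack : rel E := fun e f => f != inv e.

Definition reduced s : bool := sorted no_backtrack s.
Definition cyc_reduced s : bool := cycle no_backtrack s.
Arguments cyc_reduced : simpl never.

Definition reduced_cons e s : seq E :=
  if s is f :: s' then (if f == inv e then s' else e :: s) else [:: e].

Definition reduce s : seq E := foldr reduced_cons [::] s.

Lemma reduced_behead e s : reduced (e :: s) -> reduced s.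
Proof. exact: path_sorted. Qed.

Lemma reduced_belast s e : reduced (rcons s e) -> reduced s.
Proof.
by rewrite /reduced; case: s => //= f s; rewrite rcons_path => /andP[].
Qed.

Lemma cyc_reduced_reduced s : cyc_reduced s -> reduced s.
Proof.
by rewrite /cyc_reduced; case: s => //= e s; rewrite rcons_path => /andP[].
Qed.

Lemma reduced_cons_reduced e s : reduced s -> reduced (reduced_cons e s).
Proof.
case: s => //= f s; case: eqP => [_|/eqP f_neq]; first exact: path_sorted.
by rewrite /reduced /= /no_backtrack f_neq.
Qed.

Lemma reduce_reduced s : reduced (reduce s).
Proof. by elim: s => //= e s; apply: reduced_cons_reduced. Qed.

Lemma reduced_consK e s :
  reduced s -> reduced_cons e (reduced_cons (inv e) s) = s.
Proof.
case: s => [|f s] /=; first by rewrite eqxx.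
rewrite invK; case: eqVneq => [->|_] /=; last by rewrite eqxx.
by case: s => //= g s /andP[/negPf ->].
Qed.

Lemma reduce_id s : reduced s -> reduce s = s.
Proof.
elim: s => //= e s IHs es_red; rewrite IHs; last exact: reduced_behead es_red.
by case: s es_red {IHs} => //= g s /andP[/negPf ->].
Qed.

Lemma reduce_cat s t : reduce (s ++ t) = foldr reduced_cons (reduce t) s.
Proof. exact: foldr_cat. Qed.

Lemma reduce_catr s t : reduce (s ++ reduce t) = reduce (s ++ t).
Proof. by rewrite !reduce_cat reduce_id // reduce_reduced. Qed.

Lemma reduce_catl s t : reduce (reduce s ++ t) = reduce (s ++ t).
Proof.
elim: s => //= e s <-; case: (reduce s) => [//|f r] /=.
by case: eqVneq => [->|_] //=; rewrite reduced_consK // reduce_reduced.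
Qed.

Lemma reduce_backtrack s e t : reduce (s ++ e :: inv e :: t) = reduce (s ++ t).
Proof. by rewrite !reduce_cat /= reduced_consK // reduce_reduced. Qed.

Lemma size_reduce s : (size (reduce s) <= size s)%N.
Proof.
elim: s => //= e s IHs; apply: (@leq_trans (size (reduce s)).+1) => //.
by case: (reduce s) => //= f r; case: ifP => //= _; rewrite ltnW.
Qed.

Lemma reduced_has_backtrack s :
  ~~ reduced s -> exists a e b, s = a ++ e :: inv e :: b.
Proof.
elim: s => //= e [|f s] IHs //=; rewrite negb_and negbK => /orP[/eqP ->|/IHs].
  by exists [::], e, s.
by move=> [a [g [b ->]]]; exists (e :: a), g, b.
Qed.

Lemma reduced_cases s : reduced s ->
  cyc_reduced s \/ exists e t, s = e :: rcons t (inv e).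
Proof.
rewrite /cyc_reduced; case: s => [|e s]; first by left.
case/lastP: s => [|s f] es_red.
  by left; rewrite /= andbT /no_backtrack eq_sym.
have [->|f_neq] := eqVneq f (inv e); first by right; exists e, s.
left; rewrite /= rcons_path last_rcons; apply/andP; split=> //.
by rewrite /no_backtrack -(inj_eq (can_inj invK)) invK eq_sym.
Qed.

Definition drop_ends s : seq E := behead (take (size s).-1 s).
Arguments drop_ends : simpl never.

Fixpoint strip n s : seq E :=
  if n is n'.+1 then (if cyc_reduced s then s else strip n' (drop_ends s))
  else s.

Definition cyc_core s : seq E := strip (size s) s.

Lemma size_drop_ends s : size (drop_ends s) = (size s).-2.
Proof. by rewrite size_behead size_take; case: s => //= e s; rewrite leqnn. Qed.

Lemma strip_cyc_core n s : (size s <= n)%N -> strip n s = cyc_core s.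
Proof.
have [k] := ubnP (size s); elim: k n s => // k IHk n s lt_sk le_sn.
rewrite /cyc_core.
case: s => [|e s] in lt_sk le_sn *; first by case: n le_sn.
case: n le_sn => // n le_sn /=; case: ifP => // _.
have le_drop : (size (drop_ends (e :: s)) <= size s)%N.
  by rewrite size_drop_ends leq_pred.
by rewrite !IHk // ?(leq_ltn_trans le_drop) // (leq_trans le_drop).
Qed.

Lemma cyc_core_id s : cyc_reduced s -> cyc_core s = s.
Proof. by rewrite /cyc_core; case: s => // e s /= ->. Qed.

Lemma cyc_core_conj e s : cyc_core (e :: rcons s (inv e)) = cyc_core s.
Proof.
rewrite /cyc_core [LHS]/=.
have -> : cyc_reduced (e :: rcons s (inv e)) = false.
  rewrite /cyc_reduced /= rcons_path last_rcons /no_backtrack.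
  by rewrite invK eqxx andbF.
have -> : drop_ends (e :: rcons s (inv e)) = s.
  by rewrite /drop_ends /= size_rcons /= -cats1 take_size_cat.
by rewrite strip_cyc_core // size_rcons.
Qed.

Lemma size_cyc_core s : (size (cyc_core s) <= size s)%N.
Proof.
rewrite /cyc_core; move: {1}(size s) => n; elim: n s => //= n IHn s.
case: ifP => // _; apply: leq_trans (IHn _) _; rewrite size_drop_ends.
by rewrite -!subn1 -subnDA leq_subr.
Qed.

Lemma cyc_core_reduced_cons e s : reduced (rcons s e) ->
  roteq (cyc_core (rcons s e)) (cyc_core (reduced_cons e s)).
Proof.
case: s => [|g s] se_red /=; first exact: roteq_refl.
have [->|g_neq] := eqVneq g (inv e).
  by rewrite -[X in rcons s X]invK cyc_core_conj; apply: roteq_refl.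
have egs_cyc : cyc_reduced (e :: g :: s).
  by rewrite /cyc_reduced /= /no_backtrack g_neq; apply: se_red.
have -> : g :: rcons s e = rot 1 (e :: g :: s) by rewrite rot1_cons.
rewrite !cyc_core_id ?/cyc_reduced ?rot_cycle //.
exact/roteq_sym/roteq_rot.
Qed.

Lemma cyc_core_reduced_cons_rcons e s : reduced (rcons s (inv e)) ->
  roteq (cyc_core s) (cyc_core (reduced_cons e (rcons s (inv e)))).
Proof.
case: s => [|g s] se_red /=; first by rewrite eqxx; apply: roteq_refl.
have [g_eq|_] := eqVneq g (inv e); last first.
  by rewrite -rcons_cons cyc_core_conj; apply: roteq_refl.
rewrite {g}g_eq in se_red *; have s_cyc : cyc_reduced (inv e :: s) by [].
have -> : rcons s (inv e) = rot 1 (inv e :: s) by rewrite rot1_cons.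
rewrite !cyc_core_id ?/cyc_reduced ?rot_cycle //.
exact: roteq_rot.
Qed.

Lemma cyc_core_reduce_conj e s : reduced s ->
  roteq (cyc_core s) (cyc_core (reduce (e :: rcons s (inv e)))).
Proof.
case/lastP: s => [|s f] s_red; first by rewrite /= eqxx; apply: roteq_refl.
have [f_eq|f_neq] := eqVneq f e.
  rewrite {f}f_eq in s_red *.
  have -> : reduce (e :: rcons (rcons s e) (inv e)) = reduced_cons e s.
    rewrite /= -cats1 -cats1 -catA reduce_backtrack cats0 reduce_id //.
    exact: reduced_belast s_red.
  exact: cyc_core_reduced_cons.
have sf_red : reduced (rcons (rcons s f) (inv e)).
  case: s s_red => [|g s] /=; rewrite /reduced /=.
    by rewrite andbT /no_backtrack (inj_eq (can_inj invK)) eq_sym.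
  move=> s_red; rewrite rcons_path s_red last_rcons /no_backtrack.
  by rewrite (inj_eq (can_inj invK)) eq_sym.
by rewrite [reduce _]/= (reduce_id sf_red); apply: cyc_core_reduced_cons_rcons.
Qed.

Definition cyc_reduce s : seq E := cyc_core (reduce s).

Lemma cyc_reduce_id s : cyc_reduced s -> cyc_reduce s = s.
Proof.
by move=> s_cyc;
  rewrite /cyc_reduce reduce_id ?cyc_core_id ?cyc_reduced_reduced.
Qed.

Lemma size_cyc_reduce s : (size (cyc_reduce s) <= size s)%N.
Proof. exact: leq_trans (size_cyc_core _) (size_reduce _). Qed.

Lemma cyc_reduce_backtrack s e t :
  cyc_reduce (s ++ e :: inv e :: t) = cyc_reduce (s ++ t).
Proof. by rewrite /cyc_reduce reduce_backtrack. Qed.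

Lemma cyc_reduce_rotate e s :
  roteq (cyc_reduce (rcons s e)) (cyc_reduce (e :: s)).
Proof.
have := cyc_core_reduce_conj e (reduce_reduced (rcons s e)).
have -> : reduce (e :: rcons (reduce (rcons s e)) (inv e)) =
    reduce (e :: s) => //.
by rewrite /= -cats1 reduce_catl -cats1 -catA reduce_backtrack cats0.
Qed.

Lemma cyc_reduce_word_pow_rotate e s k :
  roteq (cyc_reduce (word_pow (rcons s e) k))
        (cyc_reduce (word_pow (e :: s) k)).
Proof.
case: k => [|k]; first exact: roteq_refl.
have := word_pow_catC [:: e] s k.+1; rewrite !cats1 => -[<-].
exact: cyc_reduce_rotate.
Qed.

Lemma reduce_word_pow_backtrack s e t k :
  reduce (word_pow (s ++ e :: inv e :: t) k) = reduce (word_pow (s ++ t) k).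
Proof.
elim: k => // k IHk; rewrite !word_powS -catA /= reduce_backtrack catA.
by rewrite -reduce_catr IHk reduce_catr.
Qed.

(* Conjugating and cancelling commute with taking powers, so the powers of [s]
   reduce to those of a single word. *)
Lemma cyc_reduce_word_pow s : exists2 w, cyc_reduced w &
  forall k, roteq (cyc_reduce (word_pow s k)) (word_pow w k).
Proof.
have [n] := ubnP (size s); elim: n s => // n IHn s lt_sn.
have [s_red|/reduced_has_backtrack[a [e [b sE]]]] := boolP (reduced s);
  last first.
  have [|w w_cyc w_pow] := IHn (a ++ b).
    by move: lt_sn; rewrite sE !size_cat /= !addnS => /ltnW.
  exists w => // k; rewrite sE /cyc_reduce reduce_word_pow_backtrack.
  exact: w_pow.
have [s_cyc|[e [t sE]]] := reduced_cases s_red.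
  exists s => // k; rewrite cyc_reduce_id; first exact: roteq_refl.
  by case: k => // k; rewrite /cyc_reduced cycle_word_pow.
have [|w w_cyc w_pow] := IHn t.
  by move: lt_sn; rewrite sE /= size_rcons ltnS => /ltnW.
exists w => // k; apply: roteq_trans (w_pow k); rewrite sE.
apply: roteq_trans (roteq_sym (cyc_reduce_word_pow_rotate _ _ k)) _.
rewrite -cats1 -cats1 -catA /= -[X in [:: _; X]]invK.
rewrite /cyc_reduce reduce_word_pow_backtrack cats0.
exact: roteq_refl.
Qed.

End FreeReduction.

(** * Primitive words *)

Section PrimitiveWords.
Variable E : eqType.
Implicit Types (s t w z : seq E).

Definition primitive_word w : Prop :=
  w != [::] /\ forall z k, w = word_pow z k -> k = 1%N.

Lemma commuting_words s t : s ++ t = t ++ s ->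
  exists w i j, s = word_pow w i /\ t = word_pow w j.
Proof.
have [n] := ubnP (size s + size t); elim: n s t => // n IHn s t.
wlog le_st : s t / (size s <= size t)%N => [le_case|].
  have [/le_case //|/ltnW le_ts] := leqP (size s) (size t).
  rewrite addnC => lt_n /esym /(le_case _ _ le_ts lt_n)[w [i [j [tE sE]]]].
  by exists w, j, i.
case: s le_st => [|e s] le_st lt_n st_ts.
  by exists t, 0%N, 1%N; rewrite word_pow1.
set u := e :: s in le_st lt_n st_ts *.
have [d tE] : exists d, t = u ++ d.
  exists (drop (size u) t); rewrite -{1}(cat_take_drop (size u) t).
  have := congr1 (take (size u)) st_ts.
  by rewrite take_size_cat // takel_cat // => <-.
rewrite {t}tE in le_st lt_n st_ts *.
have [||w [i [j [uE dE]]]] := IHn u d.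
- by rewrite -ltnS (leq_trans _ lt_n) // ltnS size_cat /u addSn ltnS leq_addl.
- by move/eqP: st_ts; rewrite -catA eqseq_cat // eqxx => /eqP.
by exists w, i, (i + j)%N; rewrite word_powD -uE -dE.
Qed.

Lemma primitive_root_exists w : w != [::] ->
  exists z k, [/\ primitive_word z, (0 < k)%N & w = word_pow z k].
Proof.
have [n] := ubnP (size w); elim: n w => // n IHn w lt_wn w_neq0.
have [[z [k [k_neq1 wE]]]|w_prim] :=
  pselect (exists z k, k <> 1%N /\ w = word_pow z k).
  have w_gt0 : (0 < k * size z)%N by rewrite -size_word_pow -wE lt0n size_eq0.
  have [k_gt0 z_gt0] : (0 < k /\ 0 < size z)%N by apply/andP; rewrite -muln_gt0.
  have [||z0 [k0 [z0_prim k0_gt0 zE]]] := IHn z; last 1 first.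
  - by exists z0, (k * k0)%N; rewrite muln_gt0 k_gt0 k0_gt0 wE zE word_powM.
  - rewrite -ltnS (leq_trans _ lt_wn) // wE size_word_pow ltnS ltn_Pmull //.
    by rewrite ltn_neqAle k_gt0 andbT eq_sym; apply/eqP.
  - by rewrite -size_eq0 -lt0n.
exists w, 1%N; rewrite word_pow1; split=> //; split=> // z k wE.
by have [//|/eqP k_neq1] := eqVneq k 1%N; case: w_prim; exists z, k.
Qed.

Lemma primitive_pow_inj z z' k k' : primitive_word z -> primitive_word z' ->
  (0 < k)%N -> (0 < k')%N -> word_pow z k = word_pow z' k' -> z = z'.
Proof.
move=> [_ z_prim] [_ z'_prim]; case: k k' => [|k] [|k'] // _ _ eq_pow.
have [w [i [j [zE z'E]]]] : exists w i j, z = word_pow w i /\ z' = word_pow w j.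
  apply: commuting_words.
  have square s t i j : word_pow s i.+1 = word_pow t j.+1 ->
      word_pow s (i.+1 + i.+1) = (s ++ t) ++ word_pow t j ++ word_pow s i.
    by move=> eq_st;
      rewrite addSn addnC word_powS word_powD eq_st word_powS -!catA.
  have := square _ _ _ _ eq_pow; rewrite word_powD eq_pow -word_powD.
  rewrite (square _ _ _ _ (esym eq_pow)) => /eqP.
  by rewrite eqseq_cat ?size_cat 1?addnC // => /andP[/eqP].
by rewrite zE (z_prim _ _ zE) z'E (z'_prim _ _ z'E).
Qed.

Lemma primitive_roteq z z' : roteq z z' -> primitive_word z ->
  primitive_word z'.
Proof.
move=> zz' [z_neq0 z_prim]; split=> [|w k z'E].
  by rewrite -size_eq0 -(roteq_size zz') size_eq0.
move: zz'; rewrite z'E => /roteq_sym/roteq_word_pow[w' _].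
exact: z_prim.
Qed.

Lemma primitive_rot_inj z i j : primitive_word z ->
  (i < size z)%N -> (j < size z)%N -> rot i z = rot j z -> i = j.
Proof.
move=> z_prim; wlog lt_ij : i j / (i < j)%N => [lt_case|].
  by case: (ltngtP i j) => // lt_ij iz jz eq_rot; [|apply/esym]; apply: lt_case.
move=> lt_iz lt_jz eq_rot.
pose y := rot i z; have y_prim := primitive_roteq (roteq_rot i z) z_prim.
have size_y : size y = size z by rewrite size_rot.
have rot_y : rot (j - i) y = y by rewrite /y -rotD subnK // ltnW.
have [w [k [l [takeE dropE]]]] : exists w k l,
    take (j - i) y = word_pow w k /\ drop (j - i) y = word_pow w l.
  by apply: commuting_words; rewrite cat_take_drop -[LHS]rot_y.
have : (k + l)%N = 1%N.
  by apply: (y_prim.2 w); rewrite word_powD -takeE -dropE cat_take_drop.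
have [k0|k_gt0] := posnP k.
  have := congr1 size takeE; rewrite k0 size_takel ?size_y /=; lia.
have [l0|l_gt0] := posnP l; last by lia.
have := congr1 size dropE; rewrite l0 size_drop size_y /=; lia.
Qed.

End PrimitiveWords.

Section CountingPowers.
Variable E : finType.
Implicit Types (w z : seq E).

Definition rotation_power z w := exists z' k, roteq z z' /\ w = word_pow z' k.

Lemma card_rotation_power m z : (0 < m)%N -> primitive_word z ->
  #|[set w : m.-tuple E | `[< rotation_power z w >]]%SET| =
  (size z * (size z %| m))%N.
Proof.
move=> m_gt0 z_prim.
have z_gt0 : (0 < size z)%N by rewrite lt0n size_eq0 z_prim.1.
have [dvd_zm|ndvd_zm] := boolP (size z %| m)%N; last first.
  rewrite muln0; apply: eq_card0 => w; rewrite !inE; apply: contraNF ndvd_zm.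
  move=> /asboolP[z' [k [zz' wE]]].
  by rewrite -(size_tuple w) wE size_word_pow (roteq_size zz') dvdn_mull.
have n_gt0 : (0 < m %/ size z)%N by rewrite divn_gt0 // dvdn_leq.
have size_pow (i : 'I_(size z)) : size (word_pow (rot i z) (m %/ size z)) == m.
  by rewrite size_word_pow size_rot divnK.
pose h (i : 'I_(size z)) : m.-tuple E := Tuple (size_pow i).
have h_inj : injective h.
  move=> i j /(congr1 val) /= eq_pow; apply/val_inj.
  apply: (primitive_rot_inj z_prim (ltn_ord i) (ltn_ord j)).
  by apply: primitive_pow_inj eq_pow => //; apply: primitive_roteq z_prim;
    apply: roteq_rot.
rewrite muln1 -[RHS]card_ord -(card_imset _ h_inj); apply: eq_card => w.
rewrite inE; apply/asboolP/imsetP => [[_ [k [[i ->] wE]]]|[i _ ->]]; last first.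
  by exists (rot i z), (m %/ size z)%N; split=> //; apply: roteq_rot.
have [j lt_jz rotE] := rot_bounded_lt i z_prim.1.
exists (Ordinal lt_jz) => //; apply/val_inj => /=.
by rewrite wE rotE -(size_tuple w) wE size_word_pow size_rot mulnK.
Qed.

(* Each word is a power of a primitive word that is unique up to rotation. *)
Lemma card_words_by_primitive_root (good : pred (seq E)) (zs : seq (seq E)) m :
  (forall w k, (0 < k)%N -> good (word_pow w k) = good w) ->
  (forall z z', roteq z z' -> good z = good z') ->
  uniq zs -> {in zs, forall z, primitive_word z /\ good z} ->
  {in zs &, forall z z', roteq z z' -> z = z'} ->
  (forall z, primitive_word z -> good z -> (size z <= m)%N ->
     exists2 z', z' \in zs & roteq z' z) ->
  (0 < m)%N ->
  #|[set w : m.-tuple E | good w]%SET| =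
  (\sum_(z <- zs) size z * (size z %| m))%N.
Proof.
move=> good_pow good_roteq zs_uniq zs_good zs_inj zs_complete m_gt0.
have count_roots (w : m.-tuple E) :
    (\sum_(z <- zs) `[< rotation_power z w >] = good w)%N.
  have w_neq0 : tval w != [::] by rewrite -size_eq0 size_tuple -lt0n.
  have [z0 [k0 [z0_prim k0_gt0 wE]]] := primitive_root_exists w_neq0.
  have rotation_powerE z : z \in zs -> rotation_power z w -> roteq z z0.
    move=> /zs_good[z_prim _] [z' [k [zz' wE']]].
    suff <- : z' = z0 by [].
    apply: (@primitive_pow_inj _ _ _ k k0) => //; last by rewrite -wE' wE.
      exact: primitive_roteq zz' z_prim.
    by case: k wE' => // w0; rewrite w0 in w_neq0.
  have good_w : good w = good z0 by rewrite wE good_pow.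
  have [z0_good|z0_bad] := boolP (good z0); last first.
    rewrite good_w (negPf z0_bad) big_seq big1 // => z zs_z.
    apply/eqP; rewrite eqb0; apply: contra z0_bad => /asboolP.
    by move=> /(rotation_powerE z zs_z) /good_roteq <-; case: (zs_good z zs_z).
  have [|z1 zs_z1 z1_z0] := zs_complete z0 z0_prim z0_good.
    by rewrite -[leqRHS](size_tuple w) wE size_word_pow leq_pmull.
  rewrite good_w z0_good (bigD1_seq z1) //= asboolT; last by exists z0, k0.
  rewrite big_seq_cond big1 // => z /andP[zs_z /eqP z_neq].
  rewrite asboolF // => /(rotation_powerE z zs_z) z_z0; apply: z_neq.
  by apply: zs_inj => //; apply: roteq_trans z_z0 (roteq_sym z1_z0).
rewrite -sum1dep_card [LHS]big_mkcond /=.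
transitivity (\sum_(w : m.-tuple E) \sum_(z <- zs) `[< rotation_power z w >])%N.
  by apply: eq_bigr => w _; rewrite count_roots; case: (good w).
rewrite exchange_big; apply: eq_big_seq => z /zs_good[z_prim _].
rewrite -card_rotation_power // -sum1dep_card [RHS]big_mkcond /=.
by apply: eq_bigr => w _; case: `[< _ >].
Qed.

End CountingPowers.

(** * Free homotopy classes of closed paths *)

Section Homotopy.
Variables (V E : choiceType) (Y : graph V E).
Implicit Types (c d : V * seq E) (v w : V) (s t : seq E) (e : E).
Local Notation cyc_reducedY := (cyc_reduced (einv Y)).
Local Notation cyc_reduceY := (cyc_reduce (einv Y)).

Lemma walk_cat v s t w :
  walk Y v (s ++ t) w <-> exists2 y, walk Y v s y & walk Y y t w.
Proof.
elim: s v => [|e s IHs] v /=.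
  by split=> [vtw|[y /eqP -> //]]; exists v.
split=> [/andP[ev /IHs[y esy ytw]]|[y /andP[ev esy] ytw]].
  by exists y; rewrite ?ev.
by rewrite ev; apply/IHs; exists y.
Qed.

Lemma walk_backtrack v s e t w :
  walk Y v (s ++ e :: einv Y e :: t) w -> walk Y v (s ++ t) w.
Proof.
move=> /walk_cat[y vsy /= /and3P[/eqP ey _ etw]].
apply/walk_cat; exists y => //.
by rewrite term_einv in etw; rewrite -ey.
Qed.

Lemma walk_end_uniq v s w w' : walk Y v s w -> walk Y v s w' -> w = w'.
Proof.
elim: s v => [|e s IHs] v /=; first by move=> /eqP <- /eqP <-.
by move=> /andP[_ esw] /andP[_ esw']; apply: IHs esw esw'.
Qed.

Lemma free_homotopic_closed c d :
  free_homotopic Y c d -> closed_path Y c /\ closed_path Y d.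
Proof.
elim=> {c d} [//|c d _ []//|c d f _ [? _] _ [_ ?]//|//|v e s es_closed].
split=> //; move: es_closed.
rewrite /closed_path /= -cats1 => /andP[/eqP ev esv].
by apply/walk_cat; exists v => //=; rewrite ev !eqxx.
Qed.

Lemma free_homotopic_cyc_reduce c d :
  free_homotopic Y c d -> roteq (cyc_reduceY c.2) (cyc_reduceY d.2).
Proof.
elim=> {c d} [c _|c d _|c d f _ cd _ df|v s t e _ _|v e s _] /=.
- exact: roteq_refl.
- exact: roteq_sym.
- exact: roteq_trans cd df.
- by rewrite (cyc_reduce_backtrack (einvK Y)); apply: roteq_refl.
- exact/roteq_sym/(cyc_reduce_rotate (einvK Y)).
Qed.

Lemma free_homotopic_roteq c d : cyc_reducedY c.2 -> cyc_reducedY d.2 ->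
  free_homotopic Y c d -> roteq c.2 d.2.
Proof.
by move=> c_cyc d_cyc /free_homotopic_cyc_reduce; rewrite !cyc_reduce_id.
Qed.

Lemma free_homotopic_conj v e s : closed_path Y (v, e :: rcons s (einv Y e)) ->
  free_homotopic Y (v, e :: rcons s (einv Y e)) (term Y e, s).
Proof.
move=> c_closed; have rotated := fh_rotate c_closed.
apply: fh_trans (rotated) _.
have [_] := free_homotopic_closed rotated.
have -> : rcons (rcons s (einv Y e)) e =
    s ++ [:: einv Y e; einv Y (einv Y e)] ++ [::].
  by rewrite einvK -cats1 -cats1 -catA.
move=> r_closed; rewrite -[X in free_homotopic _ _ (_, X)]cats0.
by apply: fh_backtrack => //; apply: walk_backtrack r_closed.
Qed.

Lemma free_homotopic_cyc_reduced c : closed_path Y c ->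
  exists2 d, free_homotopic Y c d & cyc_reducedY d.2.
Proof.
case: c => v s; have [n] := ubnP (size s).
elim: n v s => // n IHn v s lt_sn c_closed.
have shrink : cyc_reducedY s \/
    exists2 d, (size d.2 < size s)%N & free_homotopic Y (v, s) d.
  have [s_red|/reduced_has_backtrack[t1 [e [t2 sE]]]] :=
    boolP (reduced (einv Y) s).
    have [s_cyc|[e [t sE]]] := reduced_cases (einvK Y) (einv_neq Y) s_red.
      by left.
    rewrite sE in c_closed *; right; exists (term Y e, t).
      by rewrite /= size_rcons ltnW.
    exact: free_homotopic_conj.
  rewrite sE in c_closed *; right; exists (v, t1 ++ t2).
    by rewrite !size_cat /= !addnS ltnW.
  exact: (@fh_backtrack _ _ Y v t1 t2 e (walk_backtrack c_closed) c_closed).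
case: shrink => [s_cyc|[[w t] lt_ts cd]].
  by exists (v, s); first exact: fh_refl.
have [] := IHn w t _ (free_homotopic_closed cd).2.
  exact: leq_trans lt_ts _.
by move=> d df d_cyc; exists d => //; apply: fh_trans cd df.
Qed.

Lemma free_homotopic_rot c i : closed_path Y c ->
  exists v, free_homotopic Y c (v, rot i c.2).
Proof.
case: c => v s c_closed /=; have [le_is|lt_si] := leqP i (size s); last first.
  by rewrite rot_oversize 1?ltnW //; exists v; apply: fh_refl.
elim: i le_is => [|i IHi] lt_is.
  by rewrite rot0; exists v; apply: fh_refl.
have [w vw] := IHi (ltnW lt_is); have [_] := free_homotopic_closed vw.
rewrite (rotS lt_is); have : rot i s != [::].
  by rewrite -size_eq0 size_rot -lt0n (leq_ltn_trans _ lt_is).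
case rotE : (rot i s) => [|e t] // _ et_closed.
rewrite rot1_cons; exists (term Y e).
by apply: fh_trans vw _; rewrite rotE; apply: fh_rotate.
Qed.

Lemma primitive_path_homotopic c d :
  free_homotopic Y c d -> primitive_path Y c -> primitive_path Y d.
Proof.
move=> cd [_ c_prim]; split=> [|f k f_closed k_ge2 df].
  exact: (free_homotopic_closed cd).2.
exact: c_prim f_closed k_ge2 (fh_trans cd df).
Qed.

Lemma primitive_path_neq_nil c : primitive_path Y c -> c.2 != [::].
Proof.
case: c => v s [c_closed c_prim]; apply/eqP => /= s_nil.
rewrite {s}s_nil in c_closed c_prim.
by apply: (c_prim (v, [::]) 2%N) => //; apply: fh_refl.
Qed.

Lemma eq_homotopy_class c d :
  free_homotopic Y c d -> homotopy_class Y c = homotopy_class Y d.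
Proof.
move=> cd; apply/seteqP; split=> f; first exact: fh_trans (fh_sym cd).
exact: fh_trans cd.
Qed.

Lemma homotopy_class_inj c d : closed_path Y d ->
  homotopy_class Y c = homotopy_class Y d -> free_homotopic Y c d.
Proof.
move=> d_closed cd; rewrite -[free_homotopic Y c d]/(homotopy_class Y c d) cd.
exact: fh_refl.
Qed.

Lemma class_len_cyc_reduced c : closed_path Y c -> cyc_reducedY c.2 ->
  class_len (homotopy_class Y c) = size c.2.
Proof.
move=> c_closed c_cyc.
have c_min d : homotopy_class Y c d -> (size c.2 <= size d.2)%N.
  move=> /free_homotopic_cyc_reduce/roteq_size.
  by rewrite cyc_reduce_id // => ->; apply: size_cyc_reduce.
have cc : homotopy_class Y c c by apply: fh_refl.
apply: xget_unique => /= [|n [[d cd <-] d_min]]; first by split=> //; exists c.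
by apply/eqP; rewrite eqn_leq d_min // c_min.
Qed.

Lemma path_nonbackE x e s : path (nonback Y) e (rcons s x) =
  walk Y (term Y e) s (org Y x) && path (no_backtrack (einv Y)) e (rcons s x).
Proof.
elim: s e => [|f s IHs] e /=; first by rewrite !andbT.
rewrite IHs /nonback /no_backtrack [org Y f == _]eq_sym.
by case: (term Y e == _) => //=; rewrite andbCA.
Qed.

Lemma cycle_nonbackE e s : cycle (nonback Y) (e :: s) =
  closed_path Y (org Y e, e :: s) && cyc_reducedY (e :: s).
Proof. by rewrite /closed_path /cyc_reduced /= eqxx path_nonbackE. Qed.

Lemma closed_path_cycle_nonback c : closed_path Y c -> cyc_reducedY c.2 ->
  cycle (nonback Y) c.2.
Proof.
case: c => v [|e s] // c_closed c_cyc; rewrite cycle_nonbackE c_cyc andbT.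
by move: c_closed; rewrite /closed_path /= => /andP[/eqP <-]; rewrite eqxx.
Qed.

End Homotopy.

Section Action.
Variables (V E : choiceType) (Y : graph V E) (a : zaction Y).
Implicit Types (c d : V * seq E) (v w : V) (s t : seq E) (e : E).

Lemma actVK k : cancel (actV a k) (actV a (- k)).
Proof. by move=> y; rewrite -actVD addNr actV0. Qed.

Lemma actEK k : cancel (actE a k) (actE a (- k)).
Proof. by move=> e; rewrite -actED addNr actE0. Qed.

Lemma act_term k e : term Y (actE a k e) = actV a k (term Y e).
Proof. by rewrite /term act_einv act_org. Qed.

Lemma walk_act k v s w :
  walk Y (actV a k v) (map (actE a k) s) (actV a k w) = walk Y v s w.
Proof.
elim: s v => [|e s IHs] v /=; first by rewrite (can_eq (actVK k)).
by rewrite act_term act_org (can_eq (actVK k)) IHs.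
Qed.

Lemma free_homotopic_act k c d : free_homotopic Y c d ->
  free_homotopic Y (act_path a k c) (act_path a k d).
Proof.
have closed_act v s : closed_path Y (v, s) ->
    closed_path Y (actV a k v, map (actE a k) s).
  by rewrite /closed_path /= walk_act.
elim=> {c d}
  [[v s] c_closed|c d _|c d f _ cd _ df|v s t e st_closed set_closed|v e s].
- exact/fh_refl/closed_act.
- exact: fh_sym.
- exact: fh_trans cd df.
- have := closed_act _ _ set_closed; have := closed_act _ _ st_closed.
  by rewrite /act_path /= !map_cat /= -(act_einv a); apply: fh_backtrack.
- move=> /closed_act; rewrite /act_path /= map_rcons -act_term.
  exact: fh_rotate.
Qed.

Lemma act_pathD k l c : act_path a (k + l) c = act_path a k (act_path a l c).
Proof.
case: c => v s; rewrite /act_path /= actVD -map_comp; congr pair.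
by apply: eq_map => e; rewrite /= actED.
Qed.

Lemma act_path0 c : act_path a 0 c = c.
Proof.
case: c => v s; rewrite /act_path /= actV0; congr pair.
by apply: map_id_in => e _; rewrite actE0.
Qed.

Lemma act_homotopy_class k c :
  act_class a k (homotopy_class Y c) = homotopy_class Y (act_path a k c).
Proof.
apply/seteqP; split=> d /= => [[d' cd' <-]|cd]; first exact: free_homotopic_act.
exists (act_path a (- k) d); last by rewrite -act_pathD subrr act_path0.
rewrite /homotopy_class /= -[c]act_path0 -(addNr k) act_pathD.
exact: free_homotopic_act.
Qed.

Lemma homotopy_class_orbit c :
  class_orbit a (homotopy_class Y c) (homotopy_class Y c).
Proof. by exists 0 => //; rewrite act_homotopy_class act_path0. Qed.

Lemma class_orbit_act k c :
  class_orbit a (homotopy_class Y (act_path a k c)) =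
  class_orbit a (homotopy_class Y c).
Proof.
apply/seteqP; split=> g /= [l _ <-].
  by exists (l + k) => //; rewrite !act_homotopy_class act_pathD.
by exists (l - k) => //; rewrite !act_homotopy_class -act_pathD subrK.
Qed.

Hypothesis a_free : free_action a.

Lemma free_actV_inj y : injective ((actV a)^~ y).
Proof.
move=> k l eq_kl; apply/eqP; rewrite -subr_eq0; apply/eqP/(a_free (y := y)).
by rewrite addrC actVD eq_kl actVK.
Qed.

Lemma free_actE_inj e : injective ((actE a)^~ e).
Proof.
move=> k l /(congr1 (org Y)); rewrite !act_org; exact: free_actV_inj.
Qed.

(* If [t^k] rotates the edges of a cycle, all [t^(k*i)]-translates of an edge
   lie on it. *)
Lemma roteq_map_act_eq0 k s : s != [::] -> roteq s (map (actE a k) s) -> k = 0.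
Proof.
case: s => // e s _ [i rotE]; set t := e :: s in rotE.
apply/eqP/negPn/negP => k_neq0.
pose translates := [seq actE a (k *+ j) e | j <- iota 0 (size t).+1].
have translates_uniq : uniq translates.
  rewrite map_inj_uniq ?iota_uniq // => j l /free_actE_inj.
  exact: mulrIn k_neq0 _ _.
have translates_sub : {subset translates <= t}.
  move=> _ /mapP[j _ ->]; elim: j => [|j IHj].
    by rewrite mulr0n actE0 mem_head.
  by rewrite mulrS actED -(mem_rot i) -rotE map_f.
have := uniq_leq_size translates_uniq translates_sub.
by rewrite size_map size_iota ltnn.
Qed.

Lemma class_stab_cyc_reduced c :
  closed_path Y c -> cyc_reduced (einv Y) c.2 -> c.2 != [::] ->
  class_stab a (homotopy_class Y c) = [set 0].
Proof.
move=> c_closed c_cyc c_neq0; apply/seteqP; split=> k /=; last first.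
  by move=> ->; rewrite /class_stab /= act_homotopy_class act_path0.
rewrite /class_stab /= act_homotopy_class.
move=> /(homotopy_class_inj c_closed)/fh_sym c_act.
apply: (roteq_map_act_eq0 c_neq0); apply: free_homotopic_roteq c_act => //=.
rewrite /cyc_reduced cycle_map; apply: sub_cycle c_cyc => e f /=.
by apply: contra; rewrite act_einv (can_eq (actEK k)).
Qed.

End Action.

(** * Voltages and orbits of primitive classes *)

Section NetVoltage.
Variables (VX EX : finType) (X : graph VX EX) (volt : EX -> int).
Implicit Types (w : seq EX).

Definition net_voltage w : int := \sum_(e <- w) volt e.

Definition null_cycle w : bool := cycle (nonback X) w && (net_voltage w == 0).

Definition num_null_cycles m : nat :=
  #|[set w : m.-tuple EX | null_cycle w]%SET|.

Lemma net_voltage_nil : net_voltage [::] = 0.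
Proof. exact: big_nil. Qed.

Lemma net_voltage_cons e w : net_voltage (e :: w) = volt e + net_voltage w.
Proof. exact: big_cons. Qed.

Lemma net_voltage_cat w w' :
  net_voltage (w ++ w') = net_voltage w + net_voltage w'.
Proof. exact: big_cat. Qed.

Lemma net_voltage_word_pow w k :
  net_voltage (word_pow w k) = net_voltage w *+ k.
Proof.
elim: k => [|k IHk]; first by rewrite mulr0n net_voltage_nil.
by rewrite word_powS net_voltage_cat IHk mulrS.
Qed.

Lemma abs_net_voltage_le L w :
  (forall e, (`|volt e| <= L)%N) -> (`|net_voltage w| <= size w * L)%N.
Proof.
move=> volt_le; elim: w => [|e w IHw]; first by rewrite net_voltage_nil.
rewrite net_voltage_cons /= mulSn; have := volt_le e.
by move: (net_voltage w) (size w * L)%N IHw => v B; lia.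
Qed.

Lemma null_cycle_roteq w w' : roteq w w' -> null_cycle w = null_cycle w'.
Proof.
move=> [i ->]; rewrite /null_cycle rot_cycle /net_voltage.
by rewrite [in RHS](perm_big w) // perm_rot.
Qed.

Lemma null_cycle_word_pow w k :
  (0 < k)%N -> null_cycle (word_pow w k) = null_cycle w.
Proof.
move=> k_gt0; rewrite /null_cycle cycle_word_pow // net_voltage_word_pow.
by rewrite mulrn_eq0 gtn_eqF.
Qed.

Lemma num_null_cycles_le m : (num_null_cycles m <= #|EX| ^ m)%N.
Proof. by rewrite -card_tuple max_card. Qed.

End NetVoltage.

Section Orbits.
Variables (VY EY : choiceType) (Y : graph VY EY) (a : zaction Y).

Definition orbit_len (o : set (set (VY * seq EY))) : nat :=
  class_len (xget set0 o).

Definition short_orbits M : {fset set (set (VY * seq EY))} :=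
  fset_set [set o | primitive_orbits a o /\ (orbit_len o < M)%N].

End Orbits.

Section Covering.
Variables (VX EX : finType) (X : graph VX EX).
Variables (VY EY : choiceType) (Y : graph VY EY).
Variables (a : zaction Y) (p : graph_map Y X) (s : VX -> VY).
Implicit Types (y : VY) (e : EY) (f : EX) (t : seq EY) (w : seq EX).

Definition is_voltage (lift_edge : EX -> EY) (volt : EX -> int) : Prop :=
  forall f,
  [/\ mapE p (lift_edge f) = f, org Y (lift_edge f) = s (org X f)
    & term Y (lift_edge f) = actV a (volt f) (s (term X f))].

Hypotheses (a_free : free_action a) (p_quot : quotient_map a p).
Hypothesis s_lift : forall x, mapV p (s x) = x.

Lemma map_term e : term X (mapE p e) = mapV p (term Y e).
Proof. by rewrite /term map_einv map_org. Qed.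

Lemma walk_map y t y' : walk Y y t y' ->
  walk X (mapV p y) (map (mapE p) t) (mapV p y').
Proof.
elim: t y => [|e t IHt] y /=; first by move=> /eqP ->.
by move=> /andP[/eqP <- ety]; rewrite map_org eqxx /= map_term; apply: IHt.
Qed.

Lemma mapE_act k e : mapE p (actE a k e) = mapE p e.
Proof. by have [_ _ _ eq_mapE] := p_quot; apply/esym/eq_mapE; exists k. Qed.

Lemma mapV_act k y : mapV p (actV a k y) = mapV p y.
Proof. by have [_ _ eq_mapV _] := p_quot; apply/esym/eq_mapV; exists k. Qed.

Lemma lift_vertex y : exists k, y = actV a k (s (mapV p y)).
Proof. by have [_ _ eq_mapV _] := p_quot; apply/eq_mapV; rewrite s_lift. Qed.

Lemma lift_edge_uniq e e' : mapE p e = mapE p e' -> org Y e = org Y e' ->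
  e = e'.
Proof.
have [_ _ _ eq_mapE] := p_quot; move=> /eq_mapE[k ->].
by rewrite act_org => /esym/a_free ->; rewrite actE0.
Qed.

Lemma walk_lift_uniq y t z t' z' : walk Y y t z -> walk Y y t' z' ->
  map (mapE p) t = map (mapE p) t' -> t = t'.
Proof.
elim: t y t' => [|e t IHt] y [|e' t'] //= /andP[/eqP ey etz].
move=> /andP[/eqP e'y e't'z'] [map_e map_t].
have eq_e : e = e' by apply: lift_edge_uniq => //; rewrite ey e'y.
by rewrite -eq_e in e't'z' *; rewrite (IHt _ _ etz e't'z').
Qed.

Lemma voltage_exists : exists lift_edge volt, is_voltage lift_edge volt.
Proof.
have [_ mapE_surj _ _] := p_quot.
have edge_exists f : exists ek : EY * int, [/\ mapE p ek.1 = f,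
    org Y ek.1 = s (org X f) & term Y ek.1 = actV a ek.2 (s (term X f))].
  have [e0 map_e0] := mapE_surj f; have [k org_e0] := lift_vertex (org Y e0).
  pose e := actE a (- k) e0; have map_e : mapE p e = f by rewrite mapE_act.
  have [l term_e] := lift_vertex (term Y e); exists (e, l); split=> //=.
    by rewrite act_org org_e0 -map_org map_e0 actVK.
  by rewrite {1}term_e -map_term map_e.
have [lift liftP] := choice edge_exists.
by exists (fst \o lift), (snd \o lift) => f; apply: liftP.
Qed.

Variables (lift_edge : EX -> EY) (volt : EX -> int).
Hypothesis voltP : is_voltage lift_edge volt.
Local Notation null_cycle := (null_cycle X volt).

Lemma volt_einv f : volt (einv X f) = - volt f.
Proof.
have [map_f org_f term_f] := voltP f.
have [map_g org_g term_g] := voltP (einv X f).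
have lift_einv : lift_edge (einv X f) =
    actE a (- volt f) (einv Y (lift_edge f)).
  apply: lift_edge_uniq; first by rewrite map_g mapE_act -map_einv map_f.
  by rewrite org_g act_org -/(term Y (lift_edge f)) term_f actVK.
apply: (free_actV_inj a_free (y := s (org X f))) => /=.
by rewrite -[in LHS](term_einv X) -term_g lift_einv act_term term_einv org_f.
Qed.

Fixpoint lift_word k w : seq EY :=
  if w is f :: w' then actE a k (lift_edge f) :: lift_word (k + volt f) w'
  else [::].
Arguments lift_word : simpl never.

Definition lift_path k f w : VY * seq EY :=
  (actV a k (s (org X f)), lift_word k (f :: w)).

Definition word_orbit w : set (set (VY * seq EY)) :=
  if w is f :: w' then class_orbit a (homotopy_class Y (lift_path 0 f w'))
  else set0.

Lemma lift_word_cons k f w :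
  lift_word k (f :: w) = actE a k (lift_edge f) :: lift_word (k + volt f) w.
Proof. by []. Qed.

Lemma map_lift_word k w : map (mapE p) (lift_word k w) = w.
Proof.
elim: w k => // f w IHw k; rewrite lift_word_cons /= IHw mapE_act.
by have [->] := voltP f.
Qed.

Lemma lift_word_cat k w w' :
  lift_word k (w ++ w') =
  lift_word k w ++ lift_word (k + net_voltage volt w) w'.
Proof.
elim: w k => [|f w IHw] k /=; first by rewrite net_voltage_nil addr0.
by rewrite !lift_word_cons IHw net_voltage_cons addrA.
Qed.

Lemma lift_word_pow k w j : net_voltage volt w = 0 ->
  lift_word k (word_pow w j) = word_pow (lift_word k w) j.
Proof.
move=> w_null; elim: j => // j IHj.
by rewrite !word_powS lift_word_cat w_null addr0 IHj.
Qed.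

Lemma act_lift_word k l w :
  map (actE a k) (lift_word l w) = lift_word (k + l) w.
Proof.
by elim: w l => // f w IHw l; rewrite !lift_word_cons /= -actED IHw addrA.
Qed.

Lemma act_lift_path k l f w :
  act_path a k (lift_path l f w) = lift_path (k + l) f w.
Proof. by rewrite /lift_path actVD -act_lift_word. Qed.

Lemma walk_lift_word k x w x' : walk X x w x' -> walk Y (actV a k (s x))
  (lift_word k w) (actV a (k + net_voltage volt w) (s x')).
Proof.
elim: w k x => [|f w IHw] k x.
  by move=> /eqP ->; rewrite net_voltage_nil addr0 /=.
move=> /andP[/eqP <- fwx']; have [_ org_f term_f] := voltP f.
rewrite lift_word_cons /= act_org org_f eqxx /= act_term term_f -actVD.
by rewrite net_voltage_cons addrA; apply: IHw.
Qed.

Lemma closed_path_lift y t : closed_path Y (y, t) -> exists2 k,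
  (y, t) = (actV a k (s (mapV p y)), lift_word k (map (mapE p) t)) &
  net_voltage volt (map (mapE p) t) = 0.
Proof.
rewrite /closed_path /= => yty; have [k yE] := lift_vertex y; exists k.
all: have := walk_lift_word k (walk_map yty); rewrite -yE => lift_walk.
all: have tE := walk_lift_uniq yty lift_walk (esym (map_lift_word _ _)).
  by rewrite -tE.
rewrite -tE in lift_walk; have := walk_end_uniq yty lift_walk.
rewrite {1}yE => /(free_actV_inj a_free)/eqP.
by rewrite -subr_eq0 opprD addNKr oppr_eq0 => /eqP.
Qed.

Lemma lift_path_closed k f w : null_cycle (f :: w) ->
  closed_path Y (lift_path k f w).
Proof.
move=> /andP[]; rewrite cycle_nonbackE => /andP[fw_closed _] /eqP fw_null.
by have := walk_lift_word k fw_closed; rewrite fw_null addr0.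
Qed.

Lemma lift_path_cyc_reduced k f w : null_cycle (f :: w) ->
  cyc_reduced (einv Y) (lift_path k f w).2.
Proof.
move=> /andP[]; rewrite cycle_nonbackE => /andP[_ fw_cyc] _.
move: fw_cyc; rewrite -{1}(map_lift_word k (f :: w)) /cyc_reduced cycle_map.
apply: sub_cycle => e e' /=; apply: contra => /eqP ->.
by rewrite map_einv.
Qed.

Lemma null_cycle_map c : closed_path Y c -> cyc_reduced (einv Y) c.2 ->
  null_cycle (map (mapE p) c.2).
Proof.
move=> c_closed c_cyc; have := closed_path_cycle_nonback c_closed c_cyc.
case: c c_closed {c_cyc} => y t c_closed c_cycle.
have [k _ t_null] := closed_path_lift c_closed.
apply/andP; split; last by rewrite t_null.
rewrite cycle_map.
apply: sub_cycle c_cycle => e e' /=; rewrite /nonback map_term map_org.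
move=> /andP[/eqP ee' e'_neq]; rewrite ee' eqxx /=.
apply: contra e'_neq => /eqP map_e'.
by apply/eqP/lift_edge_uniq; rewrite -?ee' // map_e' map_einv.
Qed.

Lemma class_orbit_lift_path k f w :
  class_orbit a (homotopy_class Y (lift_path k f w)) = word_orbit (f :: w).
Proof. by rewrite -[k]addr0 -act_lift_path class_orbit_act. Qed.

Lemma closed_path_lift_path y t f w : closed_path Y (y, t) ->
  map (mapE p) t = f :: w -> exists k, (y, t) = lift_path k f w.
Proof.
move=> yty map_t; have [k -> _] := closed_path_lift yty; exists k.
have := walk_map yty; rewrite map_t /lift_path /=.
by move=> /andP[/eqP ->].
Qed.

Lemma class_orbit_closed_path c : closed_path Y c -> c.2 != [::] ->
  class_orbit a (homotopy_class Y c) = word_orbit (map (mapE p) c.2).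
Proof.
case: c => y t yty; case map_t : (map (mapE p) t) => [|f w] t_neq0.
  by case: t map_t t_neq0 {yty}.
have [k ->] := closed_path_lift_path yty map_t.
by rewrite class_orbit_lift_path.
Qed.

Lemma xget_word_orbit f w : exists k,
  xget set0 (word_orbit (f :: w)) = homotopy_class Y (lift_path k f w).
Proof.
have [k _ <-] := xgetI set0 (homotopy_class_orbit a (lift_path 0 f w)).
by exists k; rewrite act_homotopy_class act_lift_path addr0.
Qed.

Lemma word_orbit_len w : null_cycle w -> w != [::] ->
  orbit_len (word_orbit w) = size w.
Proof.
case: w => // f w fw_null _; rewrite /orbit_len.
have [k ->] := xget_word_orbit f w.
rewrite class_len_cyc_reduced ?lift_path_closed ?lift_path_cyc_reduced //.
by rewrite -[in RHS](map_lift_word k (f :: w)) size_map.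
Qed.

Lemma word_orbit_stab w : null_cycle w -> w != [::] ->
  class_stab a (xget set0 (word_orbit w)) = [set 0].
Proof.
case: w => // f w fw_null _; have [k ->] := xget_word_orbit f w.
by rewrite class_stab_cyc_reduced ?lift_path_closed ?lift_path_cyc_reduced.
Qed.

Lemma word_orbit_roteq z z' : null_cycle z -> null_cycle z' ->
  z != [::] -> z' != [::] -> word_orbit z = word_orbit z' -> roteq z z'.
Proof.
case: z z' => [|f w] [|f' w'] // z_null z'_null _ _ eq_orbit.
have := homotopy_class_orbit a (lift_path 0 f w).
rewrite -[class_orbit _ _]/(word_orbit (f :: w)) eq_orbit => -[k _].
rewrite act_homotopy_class act_lift_path addr0.
move=> /(homotopy_class_inj (lift_path_closed 0 z_null))/fh_sym.
move=> /(free_homotopic_roteq (lift_path_cyc_reduced 0 z_null)).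
move=> /(_ (lift_path_cyc_reduced k z'_null))/(roteq_map (mapE p)).
by rewrite !map_lift_word.
Qed.

Lemma roteq_word_orbit z z' : roteq z z' -> null_cycle z -> null_cycle z' ->
  z != [::] -> z' != [::] -> word_orbit z = word_orbit z'.
Proof.
case: z z' => [|f w] [|f' w'] // [i rotE] z_null z'_null _ _.
have [y lift_rot] := free_homotopic_rot i (lift_path_closed 0 z_null).
have map_rot_lift : map (mapE p) (rot i (lift_path 0 f w).2) = f' :: w'.
  by rewrite map_rot map_lift_word rotE.
have [_ rot_closed] := free_homotopic_closed lift_rot.
rewrite /= (eq_homotopy_class lift_rot) class_orbit_closed_path //.
  by rewrite map_rot_lift.
by rewrite -size_eq0 -(size_map (mapE p)) map_rot_lift.
Qed.

Lemma primitive_path_word c : primitive_path Y c -> cyc_reduced (einv Y) c.2 ->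
  primitive_word (map (mapE p) c.2).
Proof.
move=> c_prim c_cyc; have [c_closed no_root] := c_prim.
have c_neq0 := primitive_path_neq_nil c_prim.
split=> [|z k zE]; first by rewrite -size_eq0 size_map size_eq0.
case: k zE => [|[//|k]] zE.
  by move: c_neq0; rewrite -size_eq0 -(size_map (mapE p)) zE.
have z_null : null_cycle z.
  by rewrite -(null_cycle_word_pow _ _ _ (ltn0Sn k.+1)) -zE null_cycle_map.
case: z => [|f w] in zE z_null.
  by move: c_neq0;
    rewrite -size_eq0 -(size_map (mapE p)) zE size_word_pow muln0.
case: c c_closed zE no_root {c_prim c_neq0 c_cyc} => y t yty zE no_root.
have [j cE] := closed_path_lift_path yty zE.
case: (no_root (lift_path j f w) k.+2) => //; first exact: lift_path_closed.
suff -> : path_pow (lift_path j f w) k.+2 = (y, t) by apply: fh_refl.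
have w_null : net_voltage volt (f :: w) = 0 by case/andP: z_null => _ /eqP.
by rewrite cE; congr pair; apply/esym/(lift_word_pow j k.+2 w_null).
Qed.

Lemma primitive_orbit_word o : primitive_orbits a o ->
  exists z, [/\ null_cycle z, primitive_word z & word_orbit z = o].
Proof.
move=> [_ [c c_prim <-] <-].
have [d cd d_cyc] := free_homotopic_cyc_reduced c_prim.1.
have d_prim := primitive_path_homotopic cd c_prim.
exists (map (mapE p) d.2); split.
- exact: null_cycle_map d_prim.1 d_cyc.
- exact: primitive_path_word.
rewrite (eq_homotopy_class cd) class_orbit_closed_path //.
  exact: d_prim.1.
exact: primitive_path_neq_nil d_prim.
Qed.

Lemma word_orbit_primitive z : null_cycle z -> primitive_word z ->
  primitive_orbits a (word_orbit z).
Proof.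
case: z => [_ []//|f w] z_null z_prim.
exists (homotopy_class Y (lift_path 0 f w)) => //.
exists (lift_path 0 f w) => //; split=> [|d k d_closed k_ge2].
  exact: lift_path_closed.
have [t _ /(_ k) pow_t] := cyc_reduce_word_pow (einvK Y) (einv_neq Y) d.2.
move=> /free_homotopic_cyc_reduce;
  rewrite cyc_reduce_id ?lift_path_cyc_reduced //.
move=> /roteq_trans/(_ pow_t)/(roteq_map (mapE p)).
rewrite map_lift_word map_flatten map_nseq -/(word_pow _ _).
move=> /roteq_sym/roteq_word_pow[z' _ zE].
by move: k_ge2; rewrite (z_prim.2 _ _ zE).
Qed.

Lemma primitive_orbit_len_stab o : primitive_orbits a o ->
  (0 < orbit_len o)%N /\ class_stab a (xget set0 o) = [set 0].
Proof.
move=> /primitive_orbit_word[z [z_null [z_neq0 _] <-]].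
by rewrite word_orbit_stab // word_orbit_len // lt0n size_eq0.
Qed.

Lemma finite_short_orbits M :
  finite_set [set o | primitive_orbits a o /\ (orbit_len o < M)%N].
Proof.
pose words :=
  [seq tval w | m <- iota 0 M, w : m.-tuple EX <- enum {: m.-tuple EX}].
apply: sub_finite_set (finite_seq (map word_orbit words)) => o /= [].
move=> /primitive_orbit_word[z [z_null [z_neq0 _] <-]].
rewrite word_orbit_len // => lt_zM; apply/map_f/allpairsPdep.
by exists (size z), (in_tuple z); rewrite mem_iota mem_enum.
Qed.

Lemma mem_short_orbits M o :
  o \in short_orbits a M <-> primitive_orbits a o /\ (orbit_len o < M)%N.
Proof.
by rewrite in_fset_set;
  [split=> [/set_mem|/mem_set] | apply: finite_short_orbits].
Qed.

Lemma num_null_cyclesE M m : (0 < m < M)%N ->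
  num_null_cycles X volt m =
  (\sum_(o <- short_orbits a M) orbit_len o * (orbit_len o %| m))%N.
Proof.
move=> /andP[m_gt0 lt_mM].
have word_exists o : exists z, o \in short_orbits a M ->
    [/\ null_cycle z, primitive_word z & word_orbit z = o].
  have [/mem_short_orbits[/primitive_orbit_word[z zP] _]|] := boolP (o \in _).
    by exists z.
  by exists [::].
have [rep repP] := choice word_exists.
rewrite /num_null_cycles
  (@card_words_by_primitive_root _ _ (map rep (short_orbits a M))) //.
- rewrite big_map; apply: eq_big_seq => o /repP[z_null [z_neq0 _] zo].
  by rewrite -(word_orbit_len z_null z_neq0) zo.
- by move=> w k; apply: null_cycle_word_pow.
- exact: null_cycle_roteq.
- rewrite map_inj_in_uniq ?fset_uniq // => o o' /repP[_ _ oE] /repP[_ _ o'E].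
  by move=> eq_rep; rewrite -oE -o'E eq_rep.
- by move=> _ /mapP[o /repP[o_null o_prim _] ->].
- move=> z z' /mapP[o /repP[z_null [z_neq0 _] oE] ->{z}].
  move=> /mapP[o' /repP[z'_null [z'_neq0 _] o'E] ->{z'}] /roteq_word_orbit.
  by move=> /(_ z_null z'_null z_neq0 z'_neq0); rewrite oE o'E => ->.
move=> z z_prim z_null le_zm.
have z_orbit := word_orbit_primitive z_null z_prim.
have short_z : word_orbit z \in short_orbits a M.
  apply/mem_short_orbits; split=> //.
  by rewrite word_orbit_len ?z_prim.1 // (leq_ltn_trans le_zm).
have [rep_null [rep_neq0 _] repE] := repP _ short_z.
exists (rep (word_orbit z)); first exact: map_f.
exact: word_orbit_roteq rep_null z_null rep_neq0 z_prim.1 repE.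
Qed.

End Covering.

(** * Averages over roots of unity *)

Lemma closed_field_prim_root (C : numClosedFieldType) N : (0 < N)%N ->
  exists z : C, N.-primitive_root z.
Proof.
move=> N_gt0; pose q : {poly C} := 'X^N - 1.
have [rs qE] := closed_field_poly_normal q.
rewrite (monicP _) ?monicXnsubC // scale1r in qE.
have rs_unity : all N.-unity_root rs.
  by apply/allP => z; rewrite -root_prod_XsubC -qE.
have size_rs : (N < (size rs).+1)%N.
  by rewrite -(size_prod_XsubC rs id) -qE size_XnsubC.
have [|z] := hasP (has_prim_root N_gt0 rs_unity _ size_rs); last by exists z.
by rewrite -separable_prod_XsubC -qE separable_Xn_sub_1 // pnatr_eq0 -lt0n.
Qed.

Section PrimitiveRoots.
Variables (F : fieldType) (N : nat) (z : F).
Hypothesis z_prim : N.-primitive_root z.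

Let N_gt0 : (0 < N)%N := prim_order_gt0 z_prim.

Lemma prim_root_neq0 : z != 0.
Proof. by rewrite (prim_root_eq0 z_prim) -lt0n. Qed.

Lemma prim_rootV : N.-primitive_root z^-1.
Proof.
have -> : z^-1 = z ^+ N.-1.
  apply: (mulfI prim_root_neq0).
  by rewrite divff ?prim_root_neq0 // -exprS prednK // prim_expr_order.
by rewrite prim_root_exp_coprime // coprime_sym -{1}(prednK N_gt0) coprimeSn.
Qed.

Lemma prod_prim_root_1sub y : \prod_(i < N) (1 - z ^+ i * y) = 1 - y ^+ N.
Proof.
have [->|y_neq0] := eqVneq y 0.
  by rewrite expr0n gtn_eqF // subr0 big1 // => i _; rewrite mulr0 subr0.
have := congr1 (horner_eval y^-1) (factor_Xn_sub_1 z_prim).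
rewrite /horner_eval horner_prod big_mkord !hornerE => prodE.
transitivity (\prod_(i < N) (y * (y^-1 - z ^+ i))).
  by apply: eq_bigr => i _; rewrite mulrBr divff // [y * _]mulrC.
rewrite big_split /= prodr_const card_ord.
under [X in _ * X]eq_bigr => i _ do rewrite -hornerXsubC.
by rewrite prodE mulrBr mulr1 -exprMn divff // expr1n.
Qed.

Lemma sum_prim_root_exprz (k : int) : (`|k| < N)%N ->
  \sum_(i < N) (z ^+ i) ^ k = if k == 0 then N%:R else 0.
Proof.
move=> lt_kN; have [->|k_neq0] := eqVneq k 0.
  by under eq_bigr do rewrite expr0z; rewrite sumr_const card_ord.
have zk_neq1 : z ^ k != 1.
  have : ~~ (N %| `|k|)%N by rewrite gtnNdvd // absz_gt0.
  rewrite (prim_order_dvd z_prim); case: (k) => n; rewrite ?NegzE ?abszN //.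
  by rewrite -exprnN invr_eq1.
have /esym/eqP := subrX1 (z ^ k) N.
rewrite exprnP exprzAC -exprnP (prim_expr_order z_prim) exp1rz subrr mulf_eq0.
rewrite subr_eq0 (negPf zk_neq1) => /eqP zk_sum; rewrite -[RHS]zk_sum.
by apply: eq_bigr => i _; rewrite !exprnP exprzAC.
Qed.

End PrimitiveRoots.

Lemma norm_prim_root (C : numDomainType) N (z : C) : N.-primitive_root z ->
  `|z| = 1.
Proof.
move=> z_prim; apply/eqP; rewrite -(pexpr_eq1 (prim_order_gt0 z_prim)) //.
by rewrite -normrX (prim_expr_order z_prim) normr1.
Qed.

Lemma norm_exprz (F : numFieldType) (z : F) (k : int) : `|z ^ k| = `|z| ^ k.
Proof. by case: k => n; rewrite ?NegzE -?exprnN ?normfV normrX. Qed.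

Section VoltageWeight.
Variables (F : fieldType) (VX EX : finType) (X : graph VX EX).
Variable volt : EX -> int.

Definition volt_weight (z : F) (e : EX) : F := z ^ (- volt e).

Definition volt_edge_mx (z : F) : 'M[F]_#|EX| := edge_mx X (volt_weight z).

Lemma prod_volt_weight z w : z != 0 ->
  \prod_(e <- w) volt_weight z e = z ^ (- net_voltage volt w).
Proof.
move=> z_neq0; elim: w => [|e w IHw].
  by rewrite net_voltage_nil big_nil oppr0 expr0z.
by rewrite big_cons IHw net_voltage_cons opprD expfzDr.
Qed.

Lemma sum_mxtrace_volt_edge_mxX L N (z : F) m :
  (forall e, (`|volt e| <= L)%N) -> N.-primitive_root z ->
  (0 < m)%N -> (m * L < N)%N ->
  \sum_(i < N) \tr (volt_edge_mx (z ^+ i) ^+ m) =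
  (N * num_null_cycles X volt m)%:R.
Proof.
move=> volt_le z_prim m_gt0 lt_mLN; have z_neq0 := prim_root_neq0 z_prim.
under eq_bigr do rewrite mxtrace_edge_mxX //.
rewrite exchange_big /= /num_null_cycles -sum1dep_card mulnC natrM natr_sum.
rewrite mulr_suml [RHS]big_mkcond /=; apply: eq_bigr => w _.
under eq_bigr do rewrite prod_volt_weight ?expf_neq0 //.
rewrite -mulr_sumr sum_prim_root_exprz //; last first.
  by rewrite abszN (leq_ltn_trans (abs_net_voltage_le w volt_le)) // size_tuple.
rewrite oppr_eq0 /null_cycle; case: (cycle _ _) => /=; last by rewrite mul0r.
by case: eqP; rewrite !mul1r.
Qed.

End VoltageWeight.

Lemma norm_volt_edge_mx_le1 (F : numFieldType) (VX EX : finType)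
    (X : graph VX EX) (volt : EX -> int) (z : F) i j :
  `|z| = 1 -> `|volt_edge_mx X volt z i j| <= 1.
Proof.
move=> z_norm; rewrite mxE normrM norm_exprz z_norm exp1rz mulr1 normr_nat.
by rewrite lern1 leq_b1.
Qed.

Section VoltageDeterminant.
Variables (C : numClosedFieldType) (VX EX : finType) (X : graph VX EX).
Variable volt : EX -> int.

Lemma det_volt_edge_mx_neq0 (z u : C) : `|z| = 1 -> #|EX|%:R * `|u| < 1 ->
  \det (1%:M - u *: volt_edge_mx X volt z) != 0.
Proof.
move=> z_norm u_small.
have [lam [detE _ eigen]] := spectrum_exists (volt_edge_mx X volt z).
rewrite -horner_det_1subX detE horner_prod; apply/prodf_neq0 => i _.
have lam_le : `|lam i| <= #|EX|%:R.
  have := norm_eigenvalue_le _ (eigen i); move/(_ 1); rewrite mulr1; apply.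
  by move=> *; apply: norm_volt_edge_mx_le1.
rewrite !hornerE subr_eq0 eq_sym; apply: contraTneq u_small => lam_u.
have : `|lam i * u| <= #|EX|%:R * `|u| by rewrite normrM ler_wpM2r.
rewrite lam_u normr1 => le1.
by rewrite -real_leNgt // ?realM ?normr_real ?realn.
Qed.

Lemma det_volt_edge_mx (z u : C) : z != 0 -> 1 - u ^+ 2 != 0 ->
  (forall e, volt (einv X e) = - volt e) ->
  \det (1%:M - u *: volt_edge_mx X volt z) =
  (1 - u ^+ 2) ^ (- euler_char X) *
  \det (weighted_Delta X (volt_weight volt z) u).
Proof.
move=> z_neq0 q_neq0 volt_einv.
have weight_einv e : volt_weight volt z e * volt_weight volt z (einv X e) = 1.
  by rewrite /volt_weight volt_einv -expfzDr // subrr expr0z.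
have := bass_identity weight_einv q_neq0.
set q := 1 - u ^+ 2 in q_neq0 *.
rewrite /euler_char opprB expfzDr // -exprnN => bass.
have qV_neq0 : q ^+ #|VX| != 0 by rewrite expf_neq0.
by apply: (mulIf qV_neq0); rewrite bass -!exprnP mulrAC divfK.
Qed.

End VoltageDeterminant.

(** * Evaluation of the determinant of the Laplacian *)

Lemma tofrac_inj (A : idomainType) : injective (@tofrac A).
Proof. by move=> x y /eqP; rewrite tofrac_eq => /eqP. Qed.

Section FractionEvaluation.
Variables (A : idomainType) (F : fieldType) (ev : {rmorphism A -> F}).
Implicit Types (x y : {fraction A}) (b c : F).

(* [ev] extends to the fraction [x], with value [c]. *)
Definition frac_eval x c : Prop :=
  exists q d, [/\ ev d != 0, x * tofrac d = tofrac q & c * ev d = ev q].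

Lemma frac_eval_uniq x b c : frac_eval x b -> frac_eval x c -> b = c.
Proof.
move=> [q [d [d_neq0 xd bd]]] [q' [d' [d'_neq0 xd' cd']]].
have /tofrac_inj/(congr1 ev) : tofrac (q * d') = tofrac (q' * d).
  by rewrite !tofracM -xd -xd' mulrAC.
rewrite !rmorphM -bd -cd' => eq_bc; apply: (mulIf d_neq0).
by apply: (mulIf d'_neq0); rewrite eq_bc mulrAC.
Qed.

Lemma frac_eval_tofrac q : frac_eval (tofrac q) (ev q).
Proof. by exists q, 1; rewrite rmorph1 tofrac1 oner_neq0 !mulr1. Qed.

Lemma frac_eval_nat n : frac_eval n%:R n%:R.
Proof.
by rewrite -(rmorph_nat (@tofrac _)) -(rmorph_nat ev); apply: frac_eval_tofrac.
Qed.

Lemma frac_evalD x y b c : frac_eval x b -> frac_eval y c ->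
  frac_eval (x + y) (b + c).
Proof.
move=> [q [d [d_neq0 xd bd]]] [q' [d' [d'_neq0 yd' cd']]].
exists (q * d' + q' * d), (d * d'); split; first by rewrite rmorphM mulf_neq0.
  by rewrite tofracD !tofracM -xd -yd'; ring.
by rewrite rmorphD !rmorphM -bd -cd'; ring.
Qed.

Lemma frac_evalN x c : frac_eval x c -> frac_eval (- x) (- c).
Proof.
move=> [q [d [d_neq0 xd cd]]]; exists (- q), d; split=> //.
  by rewrite tofracN mulNr xd.
by rewrite rmorphN mulNr cd.
Qed.

Lemma frac_evalM x y b c : frac_eval x b -> frac_eval y c ->
  frac_eval (x * y) (b * c).
Proof.
move=> [q [d [d_neq0 xd bd]]] [q' [d' [d'_neq0 yd' cd']]].
exists (q * q'), (d * d'); split; first by rewrite rmorphM mulf_neq0.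
  by rewrite !tofracM -xd -yd'; ring.
by rewrite !rmorphM -bd -cd'; ring.
Qed.

Lemma frac_evalV x c : c != 0 -> frac_eval x c -> frac_eval x^-1 c^-1.
Proof.
move=> c_neq0 [q [d [d_neq0 xd cd]]]; exists d, q.
have q_neq0 : ev q != 0 by rewrite -cd mulf_neq0.
have x_neq0 : x != 0.
  apply: contraNneq q_neq0 => x0.
  by move: xd; rewrite x0 mul0r -tofrac0 => /tofrac_inj <-; rewrite rmorph0.
by split=> //; rewrite -?xd -?cd mulKf.
Qed.

Lemma frac_evalX x c n : frac_eval x c -> frac_eval (x ^+ n) (c ^+ n).
Proof.
move=> xc; elim: n => [|n IHn].
  by rewrite !expr0; apply: (frac_eval_nat 1).
by rewrite !exprS; apply: frac_evalM.
Qed.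

Lemma frac_eval_exprz x c (k : int) : c != 0 -> frac_eval x c ->
  frac_eval (x ^ k) (c ^ k).
Proof.
move=> c_neq0 xc; case: k => n; first exact: frac_evalX.
rewrite NegzE -!exprnN; apply: frac_evalV; first by rewrite expf_neq0.
exact: frac_evalX.
Qed.

Section BigOperators.
Variables (I : Type) (r : seq I) (P : pred I).
Variables (f : I -> {fraction A}) (g : I -> F).
Hypothesis fg : forall i, P i -> frac_eval (f i) (g i).

Lemma frac_eval_sum :
  frac_eval (\sum_(i <- r | P i) f i) (\sum_(i <- r | P i) g i).
Proof.
elim/big_rec2: _ => [|i y x Pi xy]; first exact: (frac_eval_nat 0).
exact: frac_evalD (fg Pi) xy.
Qed.

Lemma frac_eval_prod :
  frac_eval (\prod_(i <- r | P i) f i) (\prod_(i <- r | P i) g i).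
Proof.
elim/big_rec2: _ => [|i y x Pi xy]; first exact: (frac_eval_nat 1).
exact: frac_evalM (fg Pi) xy.
Qed.

End BigOperators.

Lemma frac_eval_det n (M : 'M[{fraction A}]_n) (N : 'M[F]_n) :
  (forall i j, frac_eval (M i j) (N i j)) -> frac_eval (\det M) (\det N).
Proof.
move=> MN; apply: frac_eval_sum => sigma _; apply: frac_evalM.
  exact/frac_evalX/frac_evalN/(frac_eval_nat 1).
by apply: frac_eval_prod => i _.
Qed.

End FractionEvaluation.

Section LaurentEvaluation.
Variables (F : numFieldType) (u z : F).

Definition eval_u : {poly int} -> F := horner_eval u \o map_poly intr.
HB.instance Definition _ :=
  GRing.RMorphism.copy eval_u (horner_eval u \o map_poly intr).

Definition eval_ut : {poly {poly int}} -> F := horner_eval z \o map_poly eval_u.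
HB.instance Definition _ :=
  GRing.RMorphism.copy eval_ut (horner_eval z \o map_poly eval_u).

Definition laurent_eval : laurent -> F -> Prop := frac_eval eval_ut.

Lemma laurent_eval_lconst c : laurent_eval (lconst c) (eval_u c).
Proof.
have -> : eval_u c = eval_ut c%:P.
  by rewrite /eval_ut /= /horner_eval map_polyC hornerC.
exact: frac_eval_tofrac.
Qed.

Lemma laurent_eval_uvar : laurent_eval uvar u.
Proof.
have := laurent_eval_lconst 'X.
by rewrite /eval_u /= /horner_eval map_polyX hornerX.
Qed.

Lemma laurent_eval_tvar : laurent_eval tvar z.
Proof.
have eval_X : eval_ut 'X = z.
  by rewrite /eval_ut /= /horner_eval map_polyX hornerX.
by have := frac_eval_tofrac eval_ut 'X; rewrite /= eval_X.
Qed.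

End LaurentEvaluation.

Lemma laurent_eval_at_cos (F : numFieldType) (P : {poly {poly int}}) (u z : F) :
  z != 0 -> laurent_eval u z (eval_at_cos P)
    (map_poly (eval_u u) P).[(z + z^-1) / 2%:R].
Proof.
move=> z_neq0; rewrite /eval_at_cos /map_poly !horner_poly.
apply: frac_eval_sum => i _; apply: frac_evalM.
  exact: laurent_eval_lconst.
apply: frac_evalX; apply: frac_evalM; last first.
  by apply: frac_evalV; [rewrite pnatr_eq0 | apply: frac_eval_nat].
apply: frac_evalD; first exact: laurent_eval_tvar.
exact/frac_evalV/laurent_eval_tvar.
Qed.

Section DeltaEvaluation.
Variables (VX EX : finType) (X : graph VX EX).
Variables (VY EY : choiceType) (Y : graph VY EY).
Variables (a : zaction Y) (p : graph_map Y X) (s : VX -> VY).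
Hypotheses (a_free : free_action a) (p_quot : quotient_map a p).
Hypothesis s_lift : forall x, mapV p (s x) = x.
Variables (lift_edge : EX -> EY) (volt : EX -> int).
Hypothesis voltP : is_voltage a p s lift_edge volt.

Lemma edges_to_lift k v w :
  [set e | org Y e = actV a k (s v) /\ term Y e = s w] =
  [set` [seq actE a k (lift_edge f) |
    f <- enum [pred f | [&& org X f == v, term X f == w & - volt f == k]]]].
Proof.
apply/seteqP; split=> [e /= [org_e term_e]|e /= /mapP[f]]; last first.
  rewrite mem_enum inE => /and3P[/eqP org_f /eqP term_f /eqP volt_f] ->.
  have [_ org_lift term_lift] := voltP f.
  rewrite act_org org_lift org_f act_term term_lift term_f.
  by rewrite -actVD -volt_f addNr actV0.
have [map_f org_f term_f] := voltP (mapE p e).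
set f := mapE p e in map_f org_f term_f.
have fv : org X f = v by rewrite map_org org_e (mapV_act p_quot) s_lift.
have fw : term X f = w by rewrite map_term term_e s_lift.
have eE : e = actE a k (lift_edge f).
  apply: (lift_edge_uniq a_free p_quot).
    by rewrite (mapE_act p_quot) map_f.
  by rewrite act_org org_f org_e fv.
apply/mapP; exists f => //; rewrite mem_enum inE fv fw !eqxx /=.
have : actV a (k + volt f) (s w) = s w.
  by rewrite actVD -fw -term_f -act_term -eE term_e fw.
by move=> /a_free/eqP; rewrite addr_eq0 eq_sym.
Qed.

Lemma adjacency_lift k v w : adjacency Y (actV a k (s v)) (s w) =
  #|[pred f | [&& org X f == v, term X f == w & - volt f == k]]|.
Proof.
rewrite /adjacency edges_to_lift; set edges := map _ _.
have -> : [set` edges] = [set` [fset e in edges]%fset].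
  by apply/seteqP; split=> e /=; rewrite inE.
rewrite set_fsetK card_fseq undup_id ?size_map -?cardE //.
rewrite map_inj_uniq ?enum_uniq // => f g /(can_inj (actEK a k)) eq_lift.
by have [<- _ _] := voltP f; have [<- _ _] := voltP g; rewrite eq_lift.
Qed.

Lemma adjacency_entryE v w : adjacency_entry a s v w =
  \sum_(f | (org X f == v) && (term X f == w)) tvar ^ (- volt f).
Proof.
pose K := [fset k in [seq - volt f | f <- enum EX]]%fset.
have volt_K f : - volt f \in K by rewrite inE; apply/map_f; rewrite mem_enum.
rewrite /adjacency_entry (fsbigTE K) => [|k K_k]; last first.
  rewrite adjacency_lift eq_card0 ?mul0r // => f; rewrite !inE.
  by apply: contraNF K_k => /and3P[_ _ /eqP <-].
transitivity (\sum_(k <- K) \sum_(f | (org X f == v) && (term X f == w))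
    if - volt f == k then tvar ^ k else 0).
  apply: eq_bigr => k _; rewrite adjacency_lift -sum1_card natr_sum mulr_suml.
  rewrite -big_mkcondr /=.
  by apply: eq_big => [f|f _]; rewrite ?inE ?andbA ?mul1r.
rewrite exchange_big /=; apply: eq_bigr => f _.
rewrite (bigD1_seq (- volt f)) ?fset_uniq //= eqxx big1 ?addr0 // => k /negPf.
by rewrite eq_sym => ->.
Qed.

Lemma laurent_eval_det_Delta (F : numFieldType) (u z : F) : z != 0 ->
  laurent_eval u z (\det (Delta_mx X a s))
    (\det (weighted_Delta X (volt_weight volt z) u)).
Proof.
move=> z_neq0; apply: frac_eval_det => i j; rewrite !mxE.
have eval_nat n : laurent_eval u z n%:R n%:R by apply: frac_eval_nat.
apply: frac_evalD; [apply: frac_evalD|].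
- exact: eval_nat.
- apply/frac_evalN/frac_evalM; first exact: laurent_eval_uvar.
  rewrite adjacency_entryE; apply: frac_eval_sum => f _.
  exact/frac_eval_exprz/laurent_eval_tvar.
apply: frac_evalM; first exact/frac_evalX/laurent_eval_uvar.
case: (i == j); rewrite ?mulr1n ?mulr0n; last exact: (eval_nat 0%N).
apply: frac_evalD; first exact: eval_nat.
exact/frac_evalN/(eval_nat 1%N).
Qed.

Lemma horner_det_Delta (F : numFieldType) (P : {poly {poly int}}) (u z : F) :
  \det (Delta_mx X a s) = eval_at_cos P -> z != 0 ->
  (map_poly (eval_u u) P).[(z + z^-1) / 2%:R] =
  \det (weighted_Delta X (volt_weight volt z) u).
Proof.
move=> P_det z_neq0; have := laurent_eval_det_Delta u z_neq0; rewrite P_det.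
exact/frac_eval_uniq/laurent_eval_at_cos.
Qed.

Lemma det_Delta_poly_neq0 (P : {poly {poly int}}) :
  \det (Delta_mx X a s) = eval_at_cos P -> P != 0.
Proof.
move=> P_det; apply/eqP => P0.
have := horner_det_Delta (0 : rat) P_det (oner_neq0 _).
rewrite P0 map_poly0 horner0 /weighted_Delta scale0r subr0 expr0n scale0r.
by rewrite addr0 det1 => /eqP; rewrite eq_sym oner_eq0.
Qed.

End DeltaEvaluation.

(** * Principal square roots *)

Section PrincipalBranches.
Variable R : realType.
Implicit Types z r : R[i].

Lemma cmod_gt0 z : z != 0 -> 0 < cmod z.
Proof.
case: z => x y; rewrite eq_complex /= negb_and /cmod /= sqrtr_gt0 => /orP[]xy.
  by rewrite ltr_pwDl ?sqr_ge0 // exprn_even_gt0.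
by rewrite ltr_wpDl ?sqr_ge0 // exprn_even_gt0.
Qed.

Lemma Re_div_cmod z : z != 0 -> -1 <= complex.Re z / cmod z <= 1.
Proof.
move=> /cmod_gt0 c_gt0; rewrite -ler_norml normrM normfV (gtr0_norm c_gt0).
by rewrite ler_pdivrMr // mul1r -sqrtr_sqr ler_wsqrtr // lerDl sqr_ge0.
Qed.

Lemma sin_acos_Re_div_cmod z : z != 0 ->
  sin (acos (complex.Re z / cmod z)) = `|complex.Im z| / cmod z.
Proof.
move=> z_neq0; have c_gt0 := cmod_gt0 z_neq0.
have c_sqr : cmod z ^+ 2 = complex.Re z ^+ 2 + complex.Im z ^+ 2.
  by rewrite sqr_sqrtr // addr_ge0 ?sqr_ge0.
rewrite sin_acos ?Re_div_cmod // -[RHS]ger0_norm ?divr_ge0 ?(ltW c_gt0) //.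
rewrite -sqrtr_sqr; congr Num.sqrt.
rewrite !expr_div_n -normrX ger0_norm ?sqr_ge0 //.
have c2_neq0 : cmod z ^+ 2 != 0 by rewrite expf_neq0 // gt_eqF.
by apply: (mulIf c2_neq0); rewrite divfK // mulrBl divfK // mul1r c_sqr; ring.
Qed.

Lemma cos_carg z : z != 0 -> cos (carg z) = complex.Re z / cmod z.
Proof.
move=> /Re_div_cmod/acos_def[_ acosK].
by rewrite /carg; case: ifP => _; rewrite ?cosN.
Qed.

Lemma sin_carg z : z != 0 -> sin (carg z) = complex.Im z / cmod z.
Proof.
move=> z_neq0; rewrite /carg; case: leP => Im_z.
  by rewrite sin_acos_Re_div_cmod // ger0_norm.
by rewrite sinN sin_acos_Re_div_cmod // ltr0_norm // mulNr opprK.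
Qed.

Lemma carg_bounds z : z != 0 ->
  if 0 <= complex.Im z then 0 <= carg z <= pi else - pi <= carg z <= 0.
Proof.
move=> /Re_div_cmod/acos_def[acos_bounds _].
rewrite /carg; case: (0 <= _) => //.
by rewrite lerN2 oppr_le0 andbC.
Qed.

Lemma cpow1 z : cpow z 1 = z.
Proof.
rewrite /cpow; case: eqVneq => [->|z_neq0]; first by rewrite oner_eq0.
have c_gt0 := cmod_gt0 z_neq0.
rewrite mul1r /cexp /clog /= lnK ?posrE // cos_carg // sin_carg //; simpc.
by case: z {z_neq0} c_gt0 => x y /= c_gt0;
  rewrite ![cmod _ * _]mulrC !divfK // gt_eqF.
Qed.

Lemma csqrt_polar z (e := expR (ln (cmod z) / 2)) (b := carg z / 2) : z != 0 ->
  csqrt z = (e * cos b +i* (e * sin b))%C.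
Proof.
move=> z_neq0; rewrite /csqrt /cpow (negPf z_neq0).
have -> : 2%:R^-1 * clog z = (ln (cmod z) / 2 +i* b)%C.
  have -> : 2%:R^-1 = (2%:R^-1)%:C%C :> R[i] by rewrite fmorphV rmorph_nat.
  by rewrite /clog; simpc; rewrite ![2^-1 * _]mulrC.
by rewrite /cexp /= -/e; simpc.
Qed.

Lemma csqrt0 : csqrt 0 = 0 :> R[i].
Proof. by rewrite /csqrt /cpow eqxx invr_eq0 pnatr_eq0. Qed.

Lemma sqr_csqrt z : csqrt z ^+ 2 = z.
Proof.
have [->|z_neq0] := eqVneq z 0; first by rewrite csqrt0 expr0n.
have c_gt0 := cmod_gt0 z_neq0; rewrite csqrt_polar //.
set e := expR _; set b := carg z / 2.
have e_sqr : e ^+ 2 = cmod z by rewrite expr2 -expRD -splitr lnK.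
have ReE : complex.Re z = cmod z * (cos b * cos b - sin b * sin b).
  by rewrite -cosD -splitr cos_carg // mulrC divfK // gt_eqF.
have ImE : complex.Im z = cmod z * (sin b * cos b + cos b * sin b).
  by rewrite -sinD -splitr sin_carg // mulrC divfK // gt_eqF.
apply/eqP; rewrite eq_complex expr2; simpc; rewrite ReE ImE -e_sqr /=.
by apply/andP; split; apply/eqP; ring.
Qed.

Lemma Re_csqrt_ge0 z : 0 <= complex.Re (csqrt z).
Proof.
have [->|z_neq0] := eqVneq z 0; first by rewrite csqrt0.
rewrite csqrt_polar //= mulr_ge0 ?expR_ge0 // cos_ge0_pihalf //.
have := pi_ge0 R; have := carg_bounds z_neq0.
by case: ifP => _ /andP[? ?] ?; apply/andP; split; lra.
Qed.

Lemma Im_csqrt_sign z : if 0 <= complex.Im z then 0 <= complex.Im (csqrt z)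
  else complex.Im (csqrt z) <= 0.
Proof.
have [->|z_neq0] := eqVneq z 0; first by rewrite csqrt0 /= lexx.
have := pi_ge0 R; have := carg_bounds z_neq0; rewrite csqrt_polar //=.
case: ifP => _ /andP[? ?] ?.
  by rewrite mulr_ge0 ?expR_ge0 // sin_ge0_pi //; apply/andP; split; lra.
rewrite mulr_ge0_le0 ?expR_ge0 // -oppr_ge0 -sinN sin_ge0_pi //.
by apply/andP; split; lra.
Qed.

Lemma norm_csqrt_subr_le z w :
  (0 <= complex.Im z) = (0 <= complex.Im w) ->
  `|csqrt z - csqrt w| <= `|csqrt z + csqrt w|.
Proof.
move=> same_half_plane; have := Im_csqrt_sign w; rewrite -same_half_plane.
have := Im_csqrt_sign z; have := Re_csqrt_ge0 z; have := Re_csqrt_ge0 w.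
move: (csqrt z) (csqrt w) => [x1 y1] [x2 y2] /= x2_ge0 x1_ge0 sign1 sign2.
have x1x2_ge0 : 0 <= x1 * x2 by rewrite mulr_ge0.
have y1y2_ge0 : 0 <= y1 * y2.
  by case: ifP sign1 sign2 => _ ? ?; [rewrite mulr_ge0 | rewrite mulr_le0].
by rewrite !normc_def lecR; apply: ler_wsqrtr; rewrite /=; nra.
Qed.

Definition joukowski_inv r : R[i] := r + csqrt (r + 1) * csqrt (r - 1).

Lemma joukowski_inv_conj r :
  joukowski_inv r * (r - csqrt (r + 1) * csqrt (r - 1)) = 1.
Proof. by rewrite mulrC -subr_sqr exprMn !sqr_csqrt; ring. Qed.

Lemma joukowski_inv_neq0 r : joukowski_inv r != 0.
Proof.
have := joukowski_inv_conj r; apply: contra_eq_neq => ->.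
by rewrite mul0r eq_sym oner_neq0.
Qed.

Lemma joukowski_invV r :
  (joukowski_inv r)^-1 = r - csqrt (r + 1) * csqrt (r - 1).
Proof.
apply: (mulfI (joukowski_inv_neq0 r)).
by rewrite divff ?joukowski_inv_neq0 // joukowski_inv_conj.
Qed.

Lemma joukowski_invK r : (joukowski_inv r + (joukowski_inv r)^-1) / 2 = r.
Proof. by rewrite joukowski_invV /joukowski_inv; field. Qed.

(* With [a = sqrt(r + 1)] and [b = sqrt(r - 1)] in a common closed quadrant,
   [r + a b = (a + b)^2 / 2] and [r - a b = (a - b)^2 / 2]. *)
Lemma norm_joukowski_invV_le1 r : `|(joukowski_inv r)^-1| <= 1.
Proof.
set a := csqrt (r + 1); set b := csqrt (r - 1).
have rE : r = (a ^+ 2 + b ^+ 2) / 2 by rewrite !sqr_csqrt; field.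
have le_norm : `|(joukowski_inv r)^-1| <= `|joukowski_inv r|.
  rewrite joukowski_invV /joukowski_inv -/a -/b.
  have -> : r + a * b = (a + b) ^+ 2 / 2 by rewrite {1}rE; field.
  have -> : r - a * b = (a - b) ^+ 2 / 2 by rewrite {1}rE; field.
  rewrite normrM [leRHS]normrM ler_wpM2r // !normrX ler_pXn2r ?nnegrE //.
  rewrite norm_csqrt_subr_le //.
  by case: (r) => x y /=; rewrite addr0 subr0.
rewrite -(@ler_pXn2r _ 2) ?nnegrE // expr1n expr2.
rewrite -[leRHS](normr1 R[i]) -(mulfV (joukowski_inv_neq0 r)) normrM.
by rewrite ler_wpM2r.
Qed.

Lemma joukowski_factor r z : z != 0 ->
  r - (z + z^-1) / 2 = joukowski_inv r / 2 *
    ((1 - z * (joukowski_inv r)^-1) * (1 - z^-1 * (joukowski_inv r)^-1)).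
Proof.
move=> z_neq0; rewrite -{1}(joukowski_invK r).
by field; rewrite z_neq0 joukowski_inv_neq0.
Qed.

End PrincipalBranches.

(** * Comparison of the edge determinants with the orbit product *)

Section EulerProducts.
Variables (F : numFieldType) (I : eqType) (r : seq I).
Variables (c : I -> F) (d : I -> nat).

Definition euler_poly : {poly F} := \prod_(i <- r) (1 - c i *: 'X^(d i)).

Lemma horner_euler_poly u :
  euler_poly.[u] = \prod_(i <- r) (1 - c i * u ^+ d i).
Proof. by rewrite horner_prod; apply: eq_bigr => i _; rewrite !hornerE. Qed.

Lemma wnorm_euler_poly_le rho : 0 <= rho ->
  wnorm rho euler_poly <= \prod_(i <- r) (1 + `|c i| * rho ^+ d i).
Proof.
move=> rho_ge0; apply: (le_trans (wnorm_prod _ _ _ rho_ge0)).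
by apply: ler_prod => i _; rewrite wnorm_ge0 // wnorm_1subXn_le.
Qed.

Hypothesis d_gt0 : {in r, forall i, (0 < d i)%N}.

Lemma euler_poly_coef0 : euler_poly`_0 = 1.
Proof.
rewrite -horner_coef0 horner_euler_poly big_seq big1 // => i /d_gt0 di_gt0.
by rewrite expr0n gtn_eqF // mulr0 subr0.
Qed.

Lemma has_logderiv_euler_poly M : has_logderiv M euler_poly
  (\poly_(k < M) if (0 < k)%N
   then \sum_(i <- r | (d i %| k)%N) (d i)%:R * c i ^+ (k %/ d i) else 0).
Proof.
rewrite /euler_poly big_seq; apply: eq_has_logderiv (has_logderiv_prod _ _);
  last first.
  by move=> i /d_gt0; apply: has_logderiv_1subXn.
move=> k lt_kM; rewrite coef_sum coef_poly lt_kM -big_seq.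
under eq_bigr do rewrite coef_poly lt_kM.
case: (0 < k)%N => /=; last by rewrite big1.
by rewrite [RHS]big_mkcond.
Qed.

End EulerProducts.

Lemma det_1subX_coef0 (R : comNzRingType) n (A : 'M[R]_n) :
  (det_1subX A)`_0 = 1.
Proof. by rewrite -horner_coef0 horner_det_1subX scale0r subr0 det1. Qed.

Section SpectralEulerProduct.
Variables (C : numClosedFieldType) (n : nat) (A : 'M[C]_n).

Lemma has_logderiv_det_1subX M : has_logderiv M (det_1subX A)
  (\poly_(k < M) if (0 < k)%N then \tr (A ^+ k) else 0).
Proof.
have [lam [-> trA _]] := spectrum_exists A.
have := @has_logderiv_euler_poly _ _ (index_enum 'I_n) lam (fun=> 1%N)
  (fun _ _ => isT) M.
rewrite /euler_poly; under eq_bigr do rewrite expr1.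
apply: eq_has_logderiv => k lt_kM; rewrite !coef_poly lt_kM.
case: (0 < k)%N => //.
by rewrite trA; apply: eq_big => [i|i _]; rewrite ?dvd1n // mul1r divn1.
Qed.

Lemma wnorm_det_1subX_le rho b : 0 <= rho -> (forall i j, `|A i j| <= b) ->
  wnorm rho (det_1subX A) <= (1 + n%:R * b * rho) ^+ n.
Proof.
move=> rho_ge0 A_le; have [lam [-> _ eigen]] := spectrum_exists A.
apply: (le_trans (wnorm_prod _ _ _ rho_ge0)).
rewrite -[X in _ ^+ X]card_ord -prodr_const; apply: ler_prod => i _.
rewrite wnorm_ge0 //= (le_trans (wnorm_1subXn_le _ 1 rho_ge0)) // expr1 lerD2l.
by rewrite ler_wpM2r // (norm_eigenvalue_le A_le (eigen i)).
Qed.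

End SpectralEulerProduct.

Section VoltageComparison.
Variables (C : numClosedFieldType) (VX EX : finType) (X : graph VX EX).
Variables (volt : EX -> int) (L N : nat) (z : C).
Hypothesis volt_le : forall e, (`|volt e| <= L)%N.
Hypothesis z_prim : N.-primitive_root z.
Variables (O : eqType) (len : O -> nat) (s : seq O) (M : nat).
Hypothesis len_gt0 : {in s, forall o, (0 < len o)%N}.
Hypothesis le_MLN : (M * L <= N)%N.
Hypothesis null_cycles_count : forall m, (0 < m < M)%N ->
  num_null_cycles X volt m = (\sum_(o <- s) len o * (len o %| m))%N.

Let det_poly : {poly C} :=
  \prod_(i < N) det_1subX (volt_edge_mx X volt (z ^+ i)).
Let orbit_poly : {poly C} := euler_poly s (fun=> 1) len.
Let log_series : {poly C} :=
  \poly_(k < M) if (0 < k)%N then (N * num_null_cycles X volt k)%:R else 0.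

Lemma has_logderiv_det_poly : has_logderiv M det_poly log_series.
Proof.
apply: eq_has_logderiv
  (has_logderiv_prod _ (fun i _ => has_logderiv_det_1subX _ _)).
move=> k lt_kM; rewrite coef_sum coef_poly lt_kM.
under eq_bigr do rewrite coef_poly lt_kM.
have [_|k_gt0] := posnP k; first by rewrite big1.
apply: (sum_mxtrace_volt_edge_mxX X volt_le z_prim k_gt0).
have [->|L_gt0] := posnP L; first by rewrite muln0 (prim_order_gt0 z_prim).
by rewrite (leq_trans _ le_MLN) // ltn_pmul2r.
Qed.

Lemma has_logderiv_orbit_poly : has_logderiv M (orbit_poly ^+ N) log_series.
Proof.
have := has_logderivX N (has_logderiv_euler_poly (fun=> 1 : C) len_gt0 M).
apply: eq_has_logderiv.
move=> k lt_kM; rewrite coefMn !coef_poly lt_kM.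
have [_|k_gt0] := posnP k; first by rewrite mul0rn.
rewrite null_cycles_count ?k_gt0 // mulnC natrM mulr_natr natr_sum big_mkcond.
congr (_ *+ _); apply: eq_bigr => o _; rewrite expr1n mulr1.
by case: (_ %| _)%N; rewrite ?muln1 ?muln0.
Qed.

Lemma dvdp_det_poly_sub_orbit_poly : 'X^M %| det_poly - orbit_poly ^+ N.
Proof.
apply: has_logderiv_inj has_logderiv_det_poly has_logderiv_orbit_poly.
  rewrite -!horner_coef0 horner_prod horner_exp horner_coef0.
  rewrite euler_poly_coef0 // expr1n big1 // => i _.
  by rewrite horner_coef0 det_1subX_coef0.
by rewrite coef_poly; case: ltnP.
Qed.

Variables (rho u : C).
Hypotheses (rho_gt0 : 0 < rho) (u_le : `|u| <= rho).
Hypothesis EX_rho : #|EX|%:R * rho <= 1.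
Hypothesis sum_rho : \sum_(o <- s) rho ^+ len o <= 2^-1.

Lemma wnorm_det_poly_le : wnorm rho det_poly <= (2 ^+ #|EX|) ^+ N.
Proof.
have rho_ge0 := ltW rho_gt0; apply: (le_trans (wnorm_prod _ _ _ rho_ge0)).
rewrite -[X in _ <= _ ^+ X]card_ord -prodr_const; apply: ler_prod => i _.
rewrite wnorm_ge0 //=;
  apply: (@le_trans _ _ ((1 + #|EX|%:R * 1 * rho) ^+ #|EX|)).
  apply: wnorm_det_1subX_le => // k l; apply: norm_volt_edge_mx_le1.
  by rewrite normrX (norm_prim_root z_prim) expr1n.
have EX_rho_ge0 : 0 <= #|EX|%:R * rho by rewrite mulr_ge0.
by rewrite mulr1 lerXn2r ?nnegrE ?addr_ge0 // -[2]/(1 + 1) lerD2l.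
Qed.

Lemma wnorm_orbit_poly_le : wnorm rho (orbit_poly ^+ N) <= 2 ^+ N.
Proof.
have rho_ge0 := ltW rho_gt0; apply: (le_trans (wnormX _ _ rho_ge0)).
rewrite lerXn2r ?nnegrE ?wnorm_ge0 //
  (le_trans (wnorm_euler_poly_le _ _ _ rho_ge0)) //.
under eq_bigr do rewrite normr1 mul1r.
apply: (le_trans (prod1D_le_half _ sum_rho)) => [o|].
  by rewrite exprn_ge0.
by rewrite -[leRHS]/(1 + 1) lerD2l mulrC -ler_pdivlMr // div1r.
Qed.

Lemma norm_prod_det_sub_orbit_prod_le :
  `|\prod_(i < N) \det (1%:M - u *: volt_edge_mx X volt (z ^+ i)) -
    (\prod_(o <- s) (1 - u ^+ len o)) ^+ N|
  <= 2 * (`|u| / rho) ^+ M * (2 ^+ #|EX|.+1) ^+ N.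
Proof.
have -> : \prod_(i < N) \det (1%:M - u *: volt_edge_mx X volt (z ^+ i)) =
    det_poly.[u].
  by rewrite horner_prod; apply: eq_bigr => i _; rewrite horner_det_1subX.
have -> : (\prod_(o <- s) (1 - u ^+ len o)) ^+ N = (orbit_poly ^+ N).[u].
  rewrite horner_exp horner_euler_poly; congr (_ ^+ _).
  by apply: eq_bigr => o _; rewrite mul1r.
have rho_ge0 := ltW rho_gt0; rewrite -hornerN -hornerD.
apply: (le_trans
  (norm_horner_dvd_Xn_le rho_gt0 u_le dvdp_det_poly_sub_orbit_poly)).
rewrite [2 * _]mulrC -mulrA ler_wpM2l ?exprn_ge0 ?divr_ge0 //.
apply: (le_trans (wnormB _ _ rho_ge0)); rewrite mulr_natl mulr2n lerD //.
  apply: (le_trans wnorm_det_poly_le); rewrite lerXn2r ?nnegrE ?exprn_ge0 //.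
  by rewrite exprS ler_peMl ?exprn_ge0 // ler1n.
apply: (le_trans wnorm_orbit_poly_le); rewrite lerXn2r ?nnegrE ?exprn_ge0 //.
by rewrite exprS ler_peMr ?exprn_ege1 // ler1n.
Qed.

End VoltageComparison.

(** * Convergence of the zeta product *)

Section ZetaConvergence.
Variables (VX EX : finType) (X : graph VX EX).
Variables (VY EY : choiceType) (Y : graph VY EY).
Variables (a : zaction Y) (p : graph_map Y X) (s : VX -> VY).
Hypotheses (a_free : free_action a) (p_quot : quotient_map a p).
Hypothesis s_lift : forall x, mapV p (s x) = x.
Variables (lift_edge : EX -> EY) (volt : EX -> int).
Hypothesis voltP : is_voltage a p s lift_edge volt.
Local Notation orbit := (set (set (VY * seq EY))).
Implicit Types (o : orbit) (t : seq orbit).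

Lemma primitive_orbit_len_gt0 o : primitive_orbits a o -> (0 < orbit_len o)%N.
Proof. by move=> /(primitive_orbit_len_stab a_free p_quot s_lift voltP)[]. Qed.

Lemma zeta_orbit_factorE (R : realType) (u : R[i]) o : primitive_orbits a o ->
  zeta_orbit_factor a u o = 1 - u ^+ orbit_len o.
Proof.
move=> /(primitive_orbit_len_stab a_free p_quot s_lift voltP)[_ stab_o].
by rewrite /zeta_orbit_factor /zeta_factor stab_o fset_set1 cardfs1 invr1 cpow1.
Qed.

Lemma count_orbit_len_le t d : uniq t ->
  (forall o, o \in t -> primitive_orbits a o) ->
  (count (fun o => orbit_len o == d) t <= #|EX| ^ d)%N.
Proof.
move=> t_uniq t_prim; have [->|d_gt0] := posnP d.
  rewrite (@eq_in_count _ _ pred0) ?count_pred0 // => o /t_prim.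
  move=> /primitive_orbit_len_gt0.
  by rewrite lt0n => /negPf.
apply: leq_trans (num_null_cycles_le X volt d).
rewrite (num_null_cyclesE a_free p_quot s_lift voltP (M := d.+1)) ?d_gt0 //=.
apply: (@leq_trans (count (fun o => orbit_len o == d) (short_orbits a d.+1))).
  rewrite -!size_filter; apply: uniq_leq_size; first exact: filter_uniq.
  move=> o; rewrite !mem_filter => /andP[/eqP len_o to]; rewrite len_o eqxx /=.
  apply/(mem_short_orbits a_free p_quot s_lift voltP).
  by split; [apply: t_prim | rewrite len_o].
rewrite -sum1_count big_mkcond /=; apply: leq_sum => o _.
by case: eqP => // ->; rewrite dvdnn muln1.
Qed.

Lemma sum_expr_orbit_len_le (F : numFieldType) (x : F) t m : uniq t ->
  (forall o, o \in t -> primitive_orbits a o /\ (m <= orbit_len o)%N) ->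
  0 <= x -> #|EX|%:R * x < 1 ->
  \sum_(o <- t) x ^+ orbit_len o <= (#|EX|%:R * x) ^+ m / (1 - #|EX|%:R * x).
Proof.
move=> t_uniq t_prim x_ge0 bx_lt1; rewrite big_seq.
rewrite (eq_bigl (fun o => (o \in t) && (m <= orbit_len o)%N)); last first.
  by move=> o; case: (boolP (o \in t)) => // /t_prim[_ ->].
rewrite -big_seq_cond; apply: sum_expr_len_le => // d _.
by apply: count_orbit_len_le => // o /t_prim[].
Qed.

Lemma sum_expr_orbit_len_le_half (F : numFieldType) (x : F) t : uniq t ->
  (forall o, o \in t -> primitive_orbits a o) ->
  0 <= x -> #|EX|%:R * x <= 3^-1 -> \sum_(o <- t) x ^+ orbit_len o <= 2^-1.
Proof.
move=> t_uniq t_prim x_ge0 bx_le.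
have bx_lt1 : #|EX|%:R * x < 1.
  by rewrite (le_lt_trans bx_le) // invf_lt1 ?ltr1n.
apply: le_trans (sum_expr_orbit_len_le (m := 1) t_uniq _ x_ge0 bx_lt1) _.
  by move=> o /t_prim o_prim; split=> //; apply: primitive_orbit_len_gt0.
rewrite expr1 ler_pdivrMr ?subr_gt0 // -subr_ge0; move: (_ * x) bx_le => q q_le.
have -> : 2^-1 * (1 - q) - q = 3 / 2 * (3^-1 - q) by field.
by rewrite mulr_ge0 ?divr_ge0 // subr_ge0.
Qed.

Lemma short_orbits_primitive M o : o \in short_orbits a M ->
  primitive_orbits a o.
Proof. by move=> /(mem_short_orbits a_free p_quot s_lift voltP)[]. Qed.

Lemma norm_short_orbit_prod_ge (F : numFieldType) (u : F) M :
  #|EX|%:R * `|u| <= 3^-1 ->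
  2^-1 <= `|\prod_(o <- short_orbits a M) (1 - u ^+ orbit_len o)|.
Proof.
move=> u_small.
have sum_le : \sum_(o <- short_orbits a M) `|u ^+ orbit_len o| <= 2^-1.
  under eq_bigr do rewrite normrX.
  apply: sum_expr_orbit_len_le_half => //; first exact: fset_uniq.
  by move=> o; apply: short_orbits_primitive.
have half : 2^-1 + 2^-1 = 1 :> F by field.
apply: le_trans (norm_prod1B_ge _).
  by rewrite lerBrDr -[leRHS]half lerD2l.
by rewrite (le_trans sum_le) // -[leRHS]half lerDl invr_ge0.
Qed.

Lemma zeta_partial_prods_cvg (R : realType) (u c : R[i]) :
  #|EX|%:R * `|u| < 1 ->
  (\prod_(o <- short_orbits a M) (1 - u ^+ orbit_len o) : R[i]^o) @[M --> \oo]
    --> (c : R[i]^o) ->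
  zeta_partial_prods a u --> (c : R[i]^o).
Proof.
move=> u_small short_c; set q := #|EX|%:R * `|u| in u_small.
have tail_cvg : (fun M => q ^+ M / (1 - q) : R[i]^o) @ \oo --> (0 : R[i]^o).
  have q_cvg : (q ^+ M : R[i]^o) @[M --> \oo] --> (0 : R[i]^o).
    by apply: cvg_expr_complex; rewrite ger0_norm // mulr_ge0.
  by rewrite -[X in _ --> X](mul0r (1 - q)^-1); apply: cvgM q_cvg (cvg_cst _).
have := @cvg_partial_prod_1sub R _ (primitive_orbits a) (zeta_orbit_factor a u)
  (fun o => u ^+ orbit_len o) (short_orbits a) _ c _ _ _ tail_cvg short_c.
apply.
- by move=> o; apply: zeta_orbit_factorE.
- by move=> M o; apply: short_orbits_primitive.
move=> M B B_prim B_long; under eq_bigr do rewrite normrX.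
apply: sum_expr_orbit_len_le => //; first exact: fset_uniq.
move=> o Bo; split; first exact: B_prim.
rewrite leqNgt; apply: contra (B_long o Bo) => lt_oM.
apply/(mem_short_orbits a_free p_quot s_lift voltP).
by split=> //; apply: B_prim.
Qed.
End ZetaConvergence.

(** * The zeta function at a small parameter *)

Lemma closed_field_poly_factor (F : closedFieldType) (q : {poly F}) n :
  size q = n.+1 ->
  exists c (r : 'I_n -> F), c != 0 /\ q = c *: \prod_(i < n) ((r i)%:P - 'X).
Proof.
move=> size_q; have [rs qE] := closed_field_poly_normal q.
have lead_neq0 : lead_coef q != 0.
  by rewrite lead_coef_eq0 -size_poly_eq0 size_q.
have size_rs : size rs = n.
  by move: size_q; rewrite qE size_scale // size_prod_XsubC => -[].
exists ((-1) ^+ n * lead_coef q), (fun i => rs`_i); split.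
  by rewrite mulf_neq0 // signr_eq0.
rewrite {1}qE (big_nth 0) size_rs big_mkord.
rewrite [in RHS](eq_bigr (fun i : 'I_n => (-1)%:P * ('X - (rs`_i)%:P)));
  last first.
  by move=> i _; rewrite mul_polyC scaleN1r opprB.
rewrite big_split /= prodr_const card_ord -rmorphXn mul_polyC scalerA.
by rewrite mulrAC -expr2 sqrr_sign mul1r.
Qed.

Lemma specialize_roots_near0 (R : realType) (P : {poly {poly int}}) n :
  n = (size P).-1 -> P != 0 -> exists2 d : R, 0 < d &
  forall u : R[i], exists ar : R[i] * ('I_n -> R[i]),
    0 < `|u| -> `|u| < d%:C%C ->
    ar.1 != 0 /\ specialize P u = ar.1 *: \prod_(i < n) ((ar.2 i)%:P - 'X).
Proof.
move=> n_deg P_neq0; pose lead : {poly R[i]} := map_poly intr (lead_coef P).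
have lead_neq0 : lead != 0.
  by rewrite map_poly_eq0_id0 ?lead_coef_eq0 // intr_eq0 !lead_coef_eq0.
have [d d_gt0 d_lead] := poly_neq0_near0 lead_neq0; exists d => // u.
have [u_ok|not_ok] := pselect (0 < `|u| /\ `|u| < d%:C%C); last first.
  by exists (1, fun=> 0) => u_gt0 lt_ud; case: not_ok.
have size_P : size (specialize P u) = n.+1.
  rewrite size_map_poly_id0; last exact: (d_lead u u_ok.1 u_ok.2).
  by rewrite n_deg prednK // lt0n size_poly_eq0.
by have [c [r cr]] := closed_field_poly_factor size_P; exists (c, r).
Qed.

Definition base_radius (F : numFieldType) b : F := (3 * b.+1)%:R^-1.

Definition small_radius (F : numFieldType) b L : F :=
  base_radius F b / (2 ^+ b.+2) ^+ L.

Lemma base_radius_gt0 (F : numFieldType) b : 0 < base_radius F b.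
Proof. by rewrite invr_gt0 ltr0n. Qed.

Lemma mul_base_radius_le (F : numFieldType) b : b%:R * base_radius F b <= 3^-1.
Proof.
rewrite /base_radius natrM invfM mulrCA ler_piMr ?invr_ge0 //.
by rewrite ler_pdivrMr ?ltr0n // mul1r ler_nat.
Qed.

Lemma small_radius_gt0 (F : numFieldType) b L : 0 < small_radius F b L.
Proof. by rewrite divr_gt0 ?base_radius_gt0 ?exprn_gt0. Qed.

Lemma small_radius_le (F : numFieldType) b L :
  small_radius F b L <= base_radius F b.
Proof.
rewrite ler_pdivrMr ?exprn_gt0 // ler_peMr ?(ltW (base_radius_gt0 _ _)) //.
by rewrite !exprn_ege1 // ler1n.
Qed.

Lemma small_radius_complex (R : realType) b L :
  (small_radius R b L)%:C%C = small_radius R[i] b L.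
Proof.
by rewrite /small_radius /base_radius fmorph_div fmorphV !rmorphXn !rmorph_nat.
Qed.

Section ZetaValue.
Variables (VX EX : finType) (X : graph VX EX).
Variables (VY EY : choiceType) (Y : graph VY EY).
Variables (a : zaction Y) (p : graph_map Y X) (s : VX -> VY).
Hypotheses (a_free : free_action a) (p_quot : quotient_map a p).
Hypothesis s_lift : forall x, mapV p (s x) = x.
Variables (lift_edge : EX -> EY) (volt : EX -> int) (L : nat).
Hypothesis voltP : is_voltage a p s lift_edge volt.
Hypotheses (L_gt0 : (0 < L)%N) (volt_le : forall e, (`|volt e| <= L)%N).
Variable P : {poly {poly int}}.
Hypothesis P_det : \det (Delta_mx X a s) = eval_at_cos P.
Variables (R : realType) (u alpha : R[i]) (n : nat) (r : 'I_n -> R[i]).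
Hypothesis u_small : `|u| < small_radius R[i] #|EX| L.
Hypothesis alpha_neq0 : alpha != 0.
Hypothesis P_roots : specialize P u = alpha *: \prod_(i < n) ((r i)%:P - 'X).

Local Notation T := (volt_edge_mx X volt).
Local Notation rho := (base_radius R[i] #|EX|).

Definition zeta_value : R[i] :=
  (1 - u ^+ 2) ^ (- euler_char X) * (alpha / 2 ^+ n) *
  \prod_(i < n) joukowski_inv (r i).

Let v i := (joukowski_inv (r i))^-1.

Let u_le_rho : `|u| <= rho.
Proof. exact: le_trans (ltW u_small) (small_radius_le _ _ _). Qed.

Let EX_u_le : #|EX|%:R * `|u| <= 3^-1.
Proof.
by apply: le_trans (mul_base_radius_le R[i] #|EX|); rewrite ler_wpM2l.
Qed.

Let inv3_lt1 : 3^-1 < 1 :> R[i].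
Proof. by rewrite invf_lt1 ?ltr1n. Qed.

Let EX_u_lt1 : #|EX|%:R * `|u| < 1.
Proof. exact: le_lt_trans EX_u_le inv3_lt1. Qed.

Lemma one_sub_sqr_neq0 : 1 - u ^+ 2 != 0.
Proof.
have u_lt1 : `|u| < 1.
  rewrite (le_lt_trans u_le_rho) // (le_lt_trans _ inv3_lt1) //.
  by rewrite lef_pV2 ?posrE ?ltr0n // ler_nat leq_pmulr.
rewrite subr_eq0 eq_sym; apply: contraTneq u_lt1 => u_sqr.
have /eqP : `|u| ^+ 2 = 1 by rewrite -normrX u_sqr normr1.
by rewrite pexpr_eq1 // => /eqP ->; rewrite ltxx.
Qed.

Lemma zeta_value_neq0 : zeta_value != 0.
Proof.
rewrite !mulf_neq0 ?expfz_neq0 ?one_sub_sqr_neq0 ?invr_neq0 ?expf_neq0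
  ?pnatr_eq0 //.
by apply/prodf_neq0 => i _; apply: joukowski_inv_neq0.
Qed.

Lemma det_volt_edge_mx_roots z : `|z| = 1 -> \det (1%:M - u *: T z) =
  (1 - u ^+ 2) ^ (- euler_char X) * (alpha * \prod_i (r i - (z + z^-1) / 2)).
Proof.
move=> z_norm; have z_neq0 : z != 0 by rewrite -normr_eq0 z_norm oner_eq0.
rewrite det_volt_edge_mx ?one_sub_sqr_neq0 //; last first.
  by move=> e; rewrite (volt_einv a_free p_quot voltP).
rewrite -(horner_det_Delta a_free p_quot s_lift voltP _ P_det) //.
rewrite -[map_poly _ P]/(specialize P u) P_roots hornerZ horner_prod.
by congr (_ * (_ * _)); apply: eq_bigr => i _; rewrite !hornerE.
Qed.

Lemma det_volt_edge_mx_factor z : `|z| = 1 ->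
  \det (1%:M - u *: T z) =
  zeta_value * \prod_i ((1 - z * v i) * (1 - z^-1 * v i)).
Proof.
move=> z_norm; have z_neq0 : z != 0 by rewrite -normr_eq0 z_norm oner_eq0.
rewrite det_volt_edge_mx_roots //.
under eq_bigr do rewrite joukowski_factor //.
by rewrite !big_split /= prodr_const card_ord exprVn /zeta_value; ring.
Qed.

Lemma norm_joukowski_invV_lt1 i : `|v i| < 1.
Proof.
rewrite lt_neqAle norm_joukowski_invV_le1 andbT; apply/eqP => v_norm.
have w_norm : `|joukowski_inv (r i)| = 1.
  by rewrite -[joukowski_inv _]invrK normfV v_norm invr1.
have := det_volt_edge_mx_neq0 X volt w_norm EX_u_lt1.
rewrite det_volt_edge_mx_roots // (bigD1 i) //= joukowski_invK subrr.
by rewrite mul0r !mulr0 eqxx.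
Qed.

Lemma prod_det_roots_of_unity N z : N.-primitive_root z ->
  \prod_(k < N) \det (1%:M - u *: T (z ^+ k)) =
  zeta_value ^+ N * \prod_i (1 - v i ^+ N) ^+ 2.
Proof.
move=> z_prim.
transitivity (\prod_(k < N) (zeta_value *
    \prod_i ((1 - z ^+ k * v i) * (1 - (z ^+ k)^-1 * v i)))).
  apply: eq_bigr => k _; apply: det_volt_edge_mx_factor.
  by rewrite normrX (norm_prim_root z_prim) expr1n.
rewrite big_split /= prodr_const card_ord; congr (_ * _).
rewrite exchange_big /=; apply: eq_bigr => i _.
rewrite big_split /= (prod_prim_root_1sub z_prim) expr2; congr (_ * _).
rewrite -(prod_prim_root_1sub (prim_rootV z_prim)).
by apply: eq_bigr => k _; rewrite exprVn.
Qed.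

Lemma cvg_short_orbit_prod :
  (\prod_(o <- short_orbits a M) (1 - u ^+ orbit_len o) : R[i]^o) @[M --> \oo]
    --> (zeta_value : R[i]^o).
Proof.
have rho_gt0 := base_radius_gt0 R[i] #|EX|.
apply: (@cvg_of_power_approx _ _ _ (fun N => \prod_i (1 - v i ^+ N) ^+ 2)
  L 2^-1 2 (`|u| / rho) (2 ^+ #|EX|.+1)) => //.
- exact: zeta_value_neq0.
- apply: cvg_prod_1subXn_sqr => i; apply: cvg_expr_complex.
  exact: norm_joukowski_invV_lt1.
- by rewrite invr_gt0.
- by move=> M; apply: (norm_short_orbit_prod_ge a_free p_quot s_lift voltP).
- move=> M N N_gt0 le_MLN; have [z z_prim] := closed_field_prim_root R[i] N_gt0.
  rewrite -(prod_det_roots_of_unity z_prim).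
  apply: (norm_prod_det_sub_orbit_prod_le volt_le) => //.
  - by move=> o /(short_orbits_primitive a_free p_quot s_lift voltP);
      apply: (primitive_orbit_len_gt0 a_free p_quot s_lift voltP).
  - by move=> m; apply: (num_null_cyclesE a_free p_quot s_lift voltP).
  - exact: le_trans (mul_base_radius_le _ _) (ltW inv3_lt1).
  - apply: (sum_expr_orbit_len_le_half a_free p_quot s_lift voltP) => //.
    + exact: fset_uniq.
    + by move=> o; apply: (short_orbits_primitive a_free p_quot s_lift voltP).
    + exact: ltW.
    + exact: mul_base_radius_le.
apply: cvg_expr_complex; rewrite invrK -exprSr ger0_norm.
  by rewrite mulrAC ltr_pdivrMr // mul1r -ltr_pdivlMr ?exprn_gt0.
by rewrite mulr_ge0 ?divr_ge0 ?exprn_ge0 // ltW.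
Qed.

Lemma zeta_partial_prods_cvg_value :
  zeta_partial_prods a u --> (zeta_value : R[i]^o).
Proof.
exact (zeta_partial_prods_cvg a_free p_quot s_lift voltP EX_u_lt1
  cvg_short_orbit_prod).
Qed.

End ZetaValue.

Theorem theorem2p2 (R : realType)
    (VX EX : finType) (X : graph VX EX)
    (VY EY : choiceType) (Y : graph VY EY)
    (a : zaction Y) (a_free : free_action a)
    (p : graph_map Y X) (p_quot : quotient_map a p)
    (s : VX -> VY) (s_lift : forall x, mapV p (s x) = x)
    (P : {poly {poly int}})
    (P_det : \det (Delta_mx X a s) = eval_at_cos P)
    (n : nat) (n_deg : n = (size P).-1) :
  exists rho : R, 0 < rho /\
  exists (alpha : R[i] -> R[i]) (r : 'I_n -> R[i] -> R[i]),
  forall u : R[i], 0 < `|u| -> `|u| < rho%:C%C ->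
    [/\ alpha u != 0,
        specialize P u = alpha u *: \prod_(i < n) ((r i u)%:P - 'X),
        cvg (zeta_partial_prods a u)
      & L2zeta_inv a u =
        (1 - u ^+ 2) ^ (- euler_char X) * (alpha u / 2%:R ^+ n) *
        \prod_(i < n) (r i u + csqrt (r i u + 1) * csqrt (r i u - 1))].
Proof.
have [lift_edge [volt voltP]] := voltage_exists p_quot s_lift.
pose L := (\max_e `|volt e|%N).+1.
have volt_le e : (`|volt e| <= L)%N by rewrite leqW // (leq_bigmax e).
have P_neq0 := det_Delta_poly_neq0 a_free p_quot s_lift voltP P_det.
have [d d_gt0 P_roots] := specialize_roots_near0 R n_deg P_neq0.
have [ar arP] := choice P_roots.
exists (Num.min (small_radius R #|EX| L) d); split.
  by rewrite lt_min small_radius_gt0.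
exists (fun u => (ar u).1), (fun i u => (ar u).2 i) => u u_gt0 lt_u.
have u_small : `|u| < small_radius R[i] #|EX| L.
  by rewrite (lt_le_trans lt_u) // -small_radius_complex lecR ge_min lexx.
have [|alpha_neq0 P_fact] := arP u u_gt0.
  by rewrite (lt_le_trans lt_u) // lecR ge_min lexx orbT.
have zeta_lim := zeta_partial_prods_cvg_value a_free p_quot s_lift voltP
  (ltn0Sn _) volt_le P_det u_small alpha_neq0 P_fact.
have finite_subsetsF := finite_subsets_proper (primitive_orbits a).
have zeta_limE : L2zeta_inv a u = zeta_value X u _ _ := norm_cvg_lim zeta_lim.
by split; [| | exact: cvgP zeta_lim | rewrite zeta_limE].
Qed.
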